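(* Let $(B^\ast,B)$ be a decorated 2-category. For every $\pi_2$-indexing or $\pi_2$-opindexing $\Phi$ on $(B^\ast,B)$ there exists an internalization of $(B^\ast,B)$, denoted $B\rtimes_\Phi B^\ast$, of length 1; that is, there exists a strict double category $C=B\rtimes_\Phi B^\ast$ such that $H^\ast C=(B^\ast,B)$ and $\ell C=1$.
   Context: **Double categories.** All double categories are strict. A double category $C$ consists of a category $C_0$ (objects and vertical morphisms), a category $C_1$ (whose objects are the horizontal morphisms and whose morphisms are the squares; composition in $C_1$ is vertical composition of squares, written $\boxminus$), left and right frame functors $L,R:C_1\to C_0$, a unit functor $U:C_0\to C_1$ with $LU=RU=\mathrm{id}$, and a horizontal composition functor $C_1\times_{C_0}C_1\to C_1$ (written with a vertical-bar box), strictly associative and strictly unital with respect to $U$. A square $\varphi$ in $C$ has a left frame $L(\varphi)$, a right frame $R(\varphi)$ (vertical morphisms), and a vertical domain and vertical codomain (horizontal morphisms). The horizontal identity of an object $a$ is $U(a)$, and the unit square (horizontal identity square) of a vertical morphism $f$ is $U(f)$. A square is *globular* if its left and right frames are both identity vertical morphisms. **Decorated 2-categories and internalizations.** A decorated 2-category is a pair $(B^\ast,B)$ where $B$ is a strict 2-category and $B^\ast$ is a category having the same collection of objects as $B$. For a strict double category $C$, the horizontal 2-category $HC$ has the objects of $C$ as 0-cells, the horizontal morphisms of $C$ as 1-cells, and the globular squares of $C$ as 2-cells, with the vertical and horizontal compositions of $C$. The decorated horizontalization of $C$ is the decorated 2-category $H^\ast C=(C_0,HC)$. An internalization of $(B^\ast,B)$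 is a double category $C$ with $H^\ast C=(B^\ast,B)$. **$\pi_2$-indexings.** For a 2-category $B$ and an object $a$ of $B$, $\pi_2(B,a)$ is the set of 2-cells of $B$ from the identity 1-cell of $a$ to itself; by the Eckmann–Hilton argument vertical and horizontal composition coincide on it and make it a commutative monoid. Let $\mathbf{commMon}$ be the category of commutative monoids. A $\pi_2$-indexing on $(B^\ast,B)$ is a functor $\Phi:B^\ast\to\mathbf{commMon}$ such that $\Phi(a)=\pi_2(B,a)$ for every object $a$ of $B^\ast$. A $\pi_2$-opindexing on $(B^\ast,B)$ is a $\pi_2$-indexing on $((B^\ast)^{op},B)$, i.e. a functor $\Phi:(B^\ast)^{op}\to\mathbf{commMon}$ with $\Phi(a)=\pi_2(B,a)$ for every object $a$. **Length.** A double category is globularly generated if it is generated, as a double category, by its globular squares. The globularly generated piece $\gamma C$ of a double category $C$ is the sub-double category of $C$ with the same objects, vertical morphisms and horizontal morphisms as $C$, whose squares are those generated under vertical and horizontal composition by the globular squares and the unit squares $U(f)$ of $C$. For a globularly generated double category $D$, let $V^1_D$ be the category whose morphisms are the vertical compositions of globular squares and unit squares of $D$; let $H^1_D$ be the collection of horizontal compositions of squares in $V^1_D$; and, inductively for $k\ge 1$, let $V^{k+1}_D$ be the category generated under vertical composition by the squares in $H^k_D$, and $H^{k+1}_D$ the collection of horizontal compositions of squares in $V^{k+1}_D$. The length $\ell C\in\mathbb{N}\cup\{\infty\}$ of a double category $C$ is the minimal $k\ge 1$ such that $(\gamma C)_1=V^k_{\gamma C}$ (and $\infty$ if there is no such $k$).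 In particular $\ell C=1$ means that every square of $\gamma C$ is a vertical composition of globular squares and unit squares. *)

(* Defs.v *)
From Stdlib Require Import ProofIrrelevance FunctionalExtensionality Eqdep.

Set Implicit Arguments.
Unset Strict Implicit.

(* A category with a given collection of objects, so that two structures can
   share their objects on the nose.  Composition is in diagrammatic order:
   [comp f g] is "first [f], then [g]". *)
Record Cat (ob : Type) : Type := MkCat {
  hom : ob -> ob -> Type;
  idm : forall a, hom a a;
  comp : forall a b c, hom a b -> hom b c -> hom a c;
  comp_idl : forall a b (f : hom a b), comp (idm a) f = f;
  comp_idr : forall a b (f : hom a b), comp f (idm b) = f;
  compA : forall a b c d (f : hom a b) (g : hom b c) (h : hom c d),
    comp f (comp g h) = comp (comp f g) h
}.

Arguments idm {ob} _ a.
Arguments comp {ob} _ {_ _ _} _ _.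
Arguments comp_idl {ob} _ {_ _} f.
Arguments comp_idr {ob} _ {_ _} f.
Arguments compA {ob} _ {_ _ _ _} f g h.

Definition opCat ob (A : Cat ob) : Cat ob :=
  @MkCat ob (fun a b => hom A b a) (fun a => idm A a)
    (fun a b c f g => comp A g f)
    (fun a b f => comp_idr A f) (fun a b f => comp_idl A f)
    (fun a b c d f g h => eq_sym (compA A h g f)).

Record Functor ob1 ob2 (A : Cat ob1) (B : Cat ob2) : Type := MkFunctor {
  fob : ob1 -> ob2;
  fhom : forall a b, hom A a b -> hom B (fob a) (fob b);
  fhom_id : forall a, fhom (idm A a) = idm B (fob a);
  fhom_comp : forall a b c (f : hom A a b) (g : hom A b c),
    fhom (comp A f g) = comp B (fhom f) (fhom g)
}.

Record CommMonoid : Type := MkCommMonoid {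
  carrier : Type;
  mone : carrier;
  mmul : carrier -> carrier -> carrier;
  mmul1l : forall x, mmul mone x = x;
  mmulA : forall x y z, mmul x (mmul y z) = mmul (mmul x y) z;
  mmulC : forall x y, mmul x y = mmul y x
}.

Record MonHom (M N : CommMonoid) : Type := MkMonHom {
  mfun : carrier M -> carrier N;
  mfun1 : mfun (mone M) = mone N;
  mfunM : forall x y, mfun (mmul x y) = mmul (mfun x) (mfun y)
}.

Lemma MonHom_ext M N (f g : MonHom M N) :
  (forall x, mfun f x = mfun g x) -> f = g.
Proof.
destruct f as [f f1 fM], g as [g g1 gM]; simpl; intros E.
assert (Efg : f = g) by (apply functional_extensionality; exact E).
destruct Efg.
rewrite (proof_irrelevance _ g1 f1), (proof_irrelevance _ gM fM); reflexivity.
Qed.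

Definition MonHom_id M : MonHom M M :=
  @MkMonHom M M (fun x => x) eq_refl (fun _ _ => eq_refl).

Definition MonHom_comp M N P (f : MonHom M N) (g : MonHom N P) : MonHom M P.
Proof.
refine (@MkMonHom M P (fun x => mfun g (mfun f x)) _ _).
- rewrite (mfun1 f); exact (mfun1 g).
- intros x y; rewrite (mfunM f); exact (mfunM g _ _).
Defined.

Definition commMon : Cat CommMonoid.
Proof.
refine (@MkCat CommMonoid MonHom MonHom_id MonHom_comp _ _ _);
  intros; apply MonHom_ext; reflexivity.
Defined.

(* For a family [cell] indexed by a type [I] of boundaries, strict laws such as
   associativity relate elements over boundaries that are equal only
   propositionally; they are stated as equality in [{i : I & cell i}]. *)

Definition cell_pack X (cell : X -> X -> Type) (h k : X) (x : cell h k) :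
    {p : X * X & cell (fst p) (snd p)} :=
  existT (fun p : X * X => cell (fst p) (snd p)) (h, k) x.

Record TwoCat (ob : Type) : Type := MkTwoCat {
  cells1 : Cat ob;
  cells2 : forall a b, Cat (hom cells1 a b);
  hcomp2 : forall a b c (h h' : hom cells1 a b) (k k' : hom cells1 b c),
    hom (cells2 a b) h h' -> hom (cells2 b c) k k' ->
    hom (cells2 a c) (comp cells1 h k) (comp cells1 h' k');
  hcomp2_id : forall a b c (h : hom cells1 a b) (k : hom cells1 b c),
    hcomp2 (idm (cells2 a b) h) (idm (cells2 b c) k)
    = idm (cells2 a c) (comp cells1 h k);
  hcomp2_comp : forall a b c
    (h h' h'' : hom cells1 a b) (k k' k'' : hom cells1 b c)
    (x : hom (cells2 a b) h h') (x' : hom (cells2 a b) h' h'')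
    (y : hom (cells2 b c) k k') (y' : hom (cells2 b c) k' k''),
    hcomp2 (comp (cells2 a b) x x') (comp (cells2 b c) y y')
    = comp (cells2 a c) (hcomp2 x y) (hcomp2 x' y');
  hcomp2_idl : forall a b (h h' : hom cells1 a b) (x : hom (cells2 a b) h h'),
    cell_pack (hcomp2 (idm (cells2 a a) (idm cells1 a)) x) = cell_pack x;
  hcomp2_idr : forall a b (h h' : hom cells1 a b) (x : hom (cells2 a b) h h'),
    cell_pack (hcomp2 x (idm (cells2 b b) (idm cells1 b))) = cell_pack x;
  hcomp2A : forall a b c d (h h' : hom cells1 a b) (k k' : hom cells1 b c)
    (l l' : hom cells1 c d)
    (x : hom (cells2 a b) h h') (y : hom (cells2 b c) k k')
    (z : hom (cells2 c d) l l'),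
    cell_pack (hcomp2 x (hcomp2 y z)) = cell_pack (hcomp2 (hcomp2 x y) z)
}.

Arguments hcomp2 {ob} _ {_ _ _ _ _ _ _} _ _.

Definition cast2 X (A : Cat X) (h h' k k' : X) (eh : h = h') (ek : k = k')
    (x : hom A h k) : hom A h' k' :=
  match eh in _ = u, ek in _ = v return hom A u v with
  | eq_refl, eq_refl => x
  end.

Lemma cell_pack_cast2 X (A : Cat X) (h h' k k' : X) (eh : h = h') (ek : k = k')
    (x : hom A h k) :
  cell_pack (cell := hom A) (cast2 eh ek x) = cell_pack x.
Proof. destruct eh, ek; reflexivity. Qed.

Lemma cell_pack_inj X (cell : X -> X -> Type) (h k : X) (x y : cell h k) :
  cell_pack x = cell_pack y -> x = y.
Proof. exact (inj_pair2 _ _ _ _ _). Qed.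

Lemma cast2_comp X (A : Cat X) (h h' : X) (e : h = h') (x y : hom A h h) :
  cast2 e e (comp A x y) = comp A (cast2 e e x) (cast2 e e y).
Proof. destruct e; reflexivity. Qed.

Lemma eckmann_hilton ob (B : TwoCat ob) (a : ob)
    (x y : hom (cells2 B a a) (idm (cells1 B) a) (idm (cells1 B) a)) :
  comp (cells2 B a a) x y = comp (cells2 B a a) y x.
Proof.
pose (A := cells2 B a a); pose (i := idm (cells1 B) a).
pose (e := comp_idl (cells1 B) i).
pose (T := fun u v : hom A i i => cast2 (A := A) e e (hcomp2 B u v)).
assert (Tl : forall u, T (idm A i) u = u).
{ intro u; apply (cell_pack_inj (cell := hom A)); unfold T.
  rewrite cell_pack_cast2; exact (hcomp2_idl u). }
assert (Tr : forall u, T u (idm A i) = u).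
{ intro u; apply (cell_pack_inj (cell := hom A)); unfold T.
  rewrite cell_pack_cast2; exact (hcomp2_idr u). }
assert (TM : forall u u' v v',
  T (comp A u u') (comp A v v') = comp A (T u v) (T u' v')).
{ intros; unfold T; rewrite <- cast2_comp; f_equal; apply hcomp2_comp. }
change (comp A x y = comp A y x).
transitivity (T x y).
- transitivity (T (comp A x (idm A i)) (comp A (idm A i) y)).
  + rewrite TM, Tr, Tl; reflexivity.
  + rewrite comp_idl, comp_idr; reflexivity.
- transitivity (T (comp A (idm A i) x) (comp A y (idm A i))).
  + rewrite comp_idl, comp_idr; reflexivity.
  + rewrite TM, Tl, Tr; reflexivity.
Qed.

Definition pi2 ob (B : TwoCat ob) (a : ob) : CommMonoid :=
  @MkCommMonoid
    (hom (cells2 B a a) (idm (cells1 B) a) (idm (cells1 B) a))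
    (idm (cells2 B a a) (idm (cells1 B) a))
    (fun x y => comp (cells2 B a a) x y)
    (fun x => comp_idl (cells2 B a a) x)
    (fun x y z => compA (cells2 B a a) x y z)
    (@eckmann_hilton ob B a).

Record DecTwoCat : Type := MkDecTwoCat {
  dec_ob : Type;
  dec_cat : Cat dec_ob;
  dec_two : TwoCat dec_ob
}.

Definition opDec (D : DecTwoCat) : DecTwoCat :=
  MkDecTwoCat (opCat (dec_cat D)) (dec_two D).

Record Pi2Indexing (D : DecTwoCat) : Type := MkPi2Indexing {
  pi2_functor : Functor (dec_cat D) commMon;
  pi2_functor_ob : forall a, fob pi2_functor a = pi2 (dec_two D) a
}.

Definition Pi2Opindexing (D : DecTwoCat) : Type := Pi2Indexing (opDec D).

(* A square over [h, k, f, g] has the shape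

             h
         a ----> b
       f |       | g
         c ----> d
             k

   [h] is its vertical domain, [k] its vertical codomain, [f] its left frame
   and [g] its right frame.  Thus the category C_1 is presented by the family of
   its hom-sets, fibred over the frames; L and R are the projections to them. *)
Definition SqFamily ob (V H : Cat ob) : Type :=
  forall a b c d, hom H a b -> hom H c d -> hom V a c -> hom V b d -> Type.

Record Boundary ob (V H : Cat ob) (a b c d : ob) : Type := MkBoundary {
  bdom : hom H a b;
  bcod : hom H c d;
  bleft : hom V a c;
  bright : hom V b d
}.

Definition sq_pack ob (V H : Cat ob) (S : SqFamily V H) a b c d
    (h : hom H a b) (k : hom H c d) (f : hom V a c) (g : hom V b d)
    (x : S a b c d h k f g) :
    {p : Boundary V H a b c d & S a b c d (bdom p) (bcod p) (bleft p) (bright p)} :=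
  existT
    (fun p : Boundary V H a b c d => S a b c d (bdom p) (bcod p) (bleft p) (bright p))
    (MkBoundary h k f g) x.

Record DoubleCat : Type := MkDoubleCat {
  dob : Type;
  vert : Cat dob;
  hor : Cat dob;
  sq : SqFamily vert hor;
  vid : forall a b (h : hom hor a b),
    sq h h (idm vert a) (idm vert b);
  vcomp : forall a b c d a' b' (h : hom hor a b) (k : hom hor c d)
    (l : hom hor a' b') (f : hom vert a c) (g : hom vert b d)
    (f' : hom vert c a') (g' : hom vert d b'),
    sq h k f g -> sq k l f' g' -> sq h l (comp vert f f') (comp vert g g');
  hunit : forall a c (f : hom vert a c),
    sq (idm hor a) (idm hor c) f f;
  hcomp : forall a b c d e i (h : hom hor a b) (k : hom hor c d)
    (h' : hom hor b e) (k' : hom hor d i)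
    (f : hom vert a c) (g : hom vert b d) (j : hom vert e i),
    sq h k f g -> sq h' k' g j -> sq (comp hor h h') (comp hor k k') f j;
  vcomp_idl : forall a b c d (h : hom hor a b) (k : hom hor c d)
    (f : hom vert a c) (g : hom vert b d) (x : sq h k f g),
    sq_pack (vcomp (vid h) x) = sq_pack x;
  vcomp_idr : forall a b c d (h : hom hor a b) (k : hom hor c d)
    (f : hom vert a c) (g : hom vert b d) (x : sq h k f g),
    sq_pack (vcomp x (vid k)) = sq_pack x;
  vcompA : forall a b c d a' b' a'' b''
    (h : hom hor a b) (k : hom hor c d) (l : hom hor a' b') (m : hom hor a'' b'')
    (f : hom vert a c) (g : hom vert b d) (f' : hom vert c a') (g' : hom vert d b')
    (f'' : hom vert a' a'') (g'' : hom vert b' b'')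
    (x : sq h k f g) (y : sq k l f' g') (z : sq l m f'' g''),
    sq_pack (vcomp x (vcomp y z)) = sq_pack (vcomp (vcomp x y) z);
  hunit_id : forall a, hunit (idm vert a) = vid (idm hor a);
  hunit_comp : forall a b c (f : hom vert a b) (g : hom vert b c),
    hunit (comp vert f g) = vcomp (hunit f) (hunit g);
  hcomp_vid : forall a b c (h : hom hor a b) (k : hom hor b c),
    hcomp (vid h) (vid k) = vid (comp hor h k);
  interchange : forall a b c d e i a' b' c'
    (h : hom hor a b) (k : hom hor d e) (l : hom hor a' b')
    (h' : hom hor b c) (k' : hom hor e i) (l' : hom hor b' c')
    (f1 : hom vert a d) (f2 : hom vert d a')
    (g1 : hom vert b e) (g2 : hom vert e b')
    (j1 : hom vert c i) (j2 : hom vert i c')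
    (x : sq h k f1 g1) (y : sq k l f2 g2) (x' : sq h' k' g1 j1) (y' : sq k' l' g2 j2),
    hcomp (vcomp x y) (vcomp x' y') = vcomp (hcomp x x') (hcomp y y');
  hcomp_idl : forall a b c d (h : hom hor a b) (k : hom hor c d)
    (f : hom vert a c) (g : hom vert b d) (x : sq h k f g),
    sq_pack (hcomp (hunit f) x) = sq_pack x;
  hcomp_idr : forall a b c d (h : hom hor a b) (k : hom hor c d)
    (f : hom vert a c) (g : hom vert b d) (x : sq h k f g),
    sq_pack (hcomp x (hunit g)) = sq_pack x;
  hcompA : forall a0 a1 a2 a3 b0 b1 b2 b3
    (h1 : hom hor a0 a1) (h2 : hom hor a1 a2) (h3 : hom hor a2 a3)
    (k1 : hom hor b0 b1) (k2 : hom hor b1 b2) (k3 : hom hor b2 b3)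
    (f0 : hom vert a0 b0) (f1 : hom vert a1 b1)
    (f2 : hom vert a2 b2) (f3 : hom vert a3 b3)
    (x : sq h1 k1 f0 f1) (y : sq h2 k2 f1 f2) (z : sq h3 k3 f2 f3),
    sq_pack (hcomp x (hcomp y z)) = sq_pack (hcomp (hcomp x y) z)
}.

Arguments sq _ {_ _ _ _} _ _ _ _.
Arguments vid _ {_ _} h.
Arguments vcomp _ {_ _ _ _ _ _ _ _ _ _ _ _ _} _ _.
Arguments hunit _ {_ _} f.
Arguments hcomp _ {_ _ _ _ _ _ _ _ _ _ _ _ _} _ _.

Section Horizontalization.
Variable C : DoubleCat.

Definition globular (a b : dob C) (h k : hom (hor C) a b) : Type :=
  sq C h k (idm (vert C) a) (idm (vert C) b).

Definition sqcast a b c d (h : hom (hor C) a b) (k : hom (hor C) c d)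
    (f f' : hom (vert C) a c) (g g' : hom (vert C) b d)
    (ef : f = f') (eg : g = g') (x : sq C h k f g) : sq C h k f' g' :=
  match ef in _ = u, eg in _ = v return sq C h k u v with
  | eq_refl, eq_refl => x
  end.

Lemma sq_pack_cast a b c d (h : hom (hor C) a b) (k : hom (hor C) c d)
    (f f' : hom (vert C) a c) (g g' : hom (vert C) b d)
    (ef : f = f') (eg : g = g') (x : sq C h k f g) :
  sq_pack (S := @sq C) (sqcast ef eg x) = sq_pack x.
Proof. destruct ef, eg; reflexivity. Qed.

Lemma sq_pack_inj a b c d (h : hom (hor C) a b) (k : hom (hor C) c d)
    (f : hom (vert C) a c) (g : hom (vert C) b d) (x y : sq C h k f g) :
  sq_pack (S := @sq C) x = sq_pack y -> x = y.
Proof. exact (inj_pair2 _ _ _ _ _). Qed.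

(* The vertical composite of two globular squares has frames [id ; id], which
   are equal to [id] only propositionally. *)
Definition gvcomp (a b : dob C) (h k l : hom (hor C) a b)
    (x : globular h k) (y : globular k l) : globular h l :=
  sqcast (comp_idl (vert C) (idm (vert C) a)) (comp_idl (vert C) (idm (vert C) b))
    (vcomp C x y).

Lemma vcomp_castl a b c d a' b' (h : hom (hor C) a b) (k : hom (hor C) c d)
    (l : hom (hor C) a' b') (f f1 : hom (vert C) a c) (g g1 : hom (vert C) b d)
    (f' : hom (vert C) c a') (g' : hom (vert C) d b') (ef : f = f1) (eg : g = g1)
    (x : sq C h k f g) (y : sq C k l f' g') :
  sq_pack (S := @sq C) (vcomp C (sqcast ef eg x) y) = sq_pack (vcomp C x y).
Proof. destruct ef, eg; reflexivity. Qed.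

Lemma vcomp_castr a b c d a' b' (h : hom (hor C) a b) (k : hom (hor C) c d)
    (l : hom (hor C) a' b') (f : hom (vert C) a c) (g : hom (vert C) b d)
    (f' f1 : hom (vert C) c a') (g' g1 : hom (vert C) d b')
    (ef : f' = f1) (eg : g' = g1)
    (x : sq C h k f g) (y : sq C k l f' g') :
  sq_pack (S := @sq C) (vcomp C x (sqcast ef eg y)) = sq_pack (vcomp C x y).
Proof. destruct ef, eg; reflexivity. Qed.

Lemma hcomp_cast a b c d e i (h : hom (hor C) a b) (k : hom (hor C) c d)
    (h' : hom (hor C) b e) (k' : hom (hor C) d i)
    (f f1 : hom (vert C) a c) (g g1 : hom (vert C) b d) (j j1 : hom (vert C) e i)
    (ef : f = f1) (eg : g = g1) (ej : j = j1)
    (x : sq C h k f g) (y : sq C h' k' g j) :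
  hcomp C (sqcast ef eg x) (sqcast eg ej y) = sqcast ef ej (hcomp C x y).
Proof. destruct ef, eg, ej; reflexivity. Qed.

Definition globularCat (a b : dob C) : Cat (hom (hor C) a b).
Proof.
refine (@MkCat _ (@globular a b) (fun h => vid C h)
          (fun h k l x y => gvcomp x y) _ _ _).
- intros h k x; apply sq_pack_inj; unfold gvcomp; rewrite sq_pack_cast.
  apply vcomp_idl.
- intros h k x; apply sq_pack_inj; unfold gvcomp; rewrite sq_pack_cast.
  apply vcomp_idr.
- intros h k l m x y z; apply sq_pack_inj; unfold gvcomp.
  rewrite !sq_pack_cast, vcomp_castl, vcomp_castr; apply vcompA.
Defined.

Lemma cell_pack_globular (a b : dob C) (h k h' k' : hom (hor C) a b)
    (x : globular h k) (y : globular h' k') :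
  sq_pack (S := @sq C) x = sq_pack y ->
  cell_pack (cell := @globular a b) x = cell_pack y.
Proof.
intro E.
assert (Eh : h = h') by exact (f_equal (fun s => bdom (projT1 s)) E).
assert (Ek : k = k') by exact (f_equal (fun s => bcod (projT1 s)) E).
destruct Eh, Ek; f_equal; apply sq_pack_inj; exact E.
Qed.

Definition horizontalization : TwoCat (dob C).
Proof.
refine (@MkTwoCat (dob C) (hor C) globularCat
  (fun a b c h h' k k' x y => hcomp C x y) _ _ _ _ _).
- intros a b c h k; exact (hcomp_vid h k).
- intros a b c h h' h'' k k' k'' x x' y y'; simpl; unfold gvcomp.
  rewrite hcomp_cast; f_equal; apply interchange.
- intros a b h h' x; apply cell_pack_globular; simpl; rewrite <- hunit_id.
  apply hcomp_idl.
- intros a b h h' x; apply cell_pack_globular; simpl; rewrite <- hunit_id.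
  apply hcomp_idr.
- intros a b c d h h' k k' l l' x y z; apply cell_pack_globular.
  exact (hcompA x y z).
Defined.

Definition decorated_horizontalization : DecTwoCat :=
  MkDecTwoCat (vert C) horizontalization.

End Horizontalization.

Definition internalization (D : DecTwoCat) (C : DoubleCat) : Prop :=
  decorated_horizontalization C = D.

Definition SqPred (C : DoubleCat) : Type :=
  forall a b c d (h : hom (hor C) a b) (k : hom (hor C) c d)
    (f : hom (vert C) a c) (g : hom (vert C) b d), sq C h k f g -> Prop.

Inductive generator (C : DoubleCat) : SqPred C :=
| generator_globular a b (h k : hom (hor C) a b) (x : globular h k) :
    generator (C := C) x
| generator_unit a c (f : hom (vert C) a c) : generator (C := C) (hunit C f).

Inductive vclosure (C : DoubleCat) (P : SqPred C) : SqPred C :=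
| vclosure_base a b c d (h : hom (hor C) a b) (k : hom (hor C) c d) f g
    (x : sq C h k f g) : P _ _ _ _ _ _ _ _ x -> vclosure P x
| vclosure_id a b (h : hom (hor C) a b) : vclosure P (vid C h)
| vclosure_comp a b c d a' b' (h : hom (hor C) a b) (k : hom (hor C) c d)
    (l : hom (hor C) a' b') f g f' g' (x : sq C h k f g) (y : sq C k l f' g') :
    vclosure P x -> vclosure P y -> vclosure P (vcomp C x y).

Inductive hclosure (C : DoubleCat) (P : SqPred C) : SqPred C :=
| hclosure_base a b c d (h : hom (hor C) a b) (k : hom (hor C) c d) f g
    (x : sq C h k f g) : P _ _ _ _ _ _ _ _ x -> hclosure P x
| hclosure_comp a b c d e i (h : hom (hor C) a b) (k : hom (hor C) c d)
    (h' : hom (hor C) b e) (k' : hom (hor C) d i) f g j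
    (x : sq C h k f g) (y : sq C h' k' g j) :
    hclosure P x -> hclosure P y -> hclosure P (hcomp C x y).

Inductive generated (C : DoubleCat) : SqPred C :=
| generated_base a b c d (h : hom (hor C) a b) (k : hom (hor C) c d) f g
    (x : sq C h k f g) : generator x -> generated x
| generated_vcomp a b c d a' b' (h : hom (hor C) a b) (k : hom (hor C) c d)
    (l : hom (hor C) a' b') f g f' g' (x : sq C h k f g) (y : sq C k l f' g') :
    generated x -> generated y -> generated (vcomp C x y)
| generated_hcomp a b c d e i (h : hom (hor C) a b) (k : hom (hor C) c d)
    (h' : hom (hor C) b e) (k' : hom (hor C) d i) f g j
    (x : sq C h k f g) (y : sq C h' k' g j) :
    generated x -> generated y -> generated (hcomp C x y).

Definition generated_globular (C : DoubleCat) (a b : dob C)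
    (h k : hom (hor C) a b) (x : globular h k) : generated (C := C) x :=
  generated_base (generator_globular x).

Definition generated_unit (C : DoubleCat) (a c : dob C) (f : hom (vert C) a c) :
    generated (hunit C f) :=
  generated_base (generator_unit f).

Definition gamma_sq (C : DoubleCat) : SqFamily (vert C) (hor C) :=
  fun a b c d h k f g => {x : sq C h k f g | generated x}.

Lemma gamma_sq_pack (C : DoubleCat) a b c d
    (h h' : hom (hor C) a b) (k k' : hom (hor C) c d)
    (f f' : hom (vert C) a c) (g g' : hom (vert C) b d)
    (x : sq C h k f g) (y : sq C h' k' f' g')
    (px : generated x) (py : generated y) :
  sq_pack (S := @sq C) x = sq_pack y ->
  sq_pack (S := @gamma_sq C) (exist _ x px) = sq_pack (S := @gamma_sq C) (exist _ y py).
Proof.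
intro E.
assert (Eh : h = h') by exact (f_equal (fun s => bdom (projT1 s)) E).
assert (Ek : k = k') by exact (f_equal (fun s => bcod (projT1 s)) E).
assert (Ef : f = f') by exact (f_equal (fun s => bleft (projT1 s)) E).
assert (Eg : g = g') by exact (f_equal (fun s => bright (projT1 s)) E).
destruct Eh, Ek, Ef, Eg.
apply sq_pack_inj in E; destruct E.
rewrite (proof_irrelevance _ px py); reflexivity.
Qed.

Lemma gamma_sq_eq (C : DoubleCat) a b c d (h : hom (hor C) a b) (k : hom (hor C) c d)
    f g (x y : sq C h k f g) (px : generated x) (py : generated y) :
  x = y -> exist (fun z : sq C h k f g => generated z) x px = exist _ y py.
Proof.
intro E; destruct E; rewrite (proof_irrelevance _ px py); reflexivity.
Qed.

Definition gamma (C : DoubleCat) : DoubleCat.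
Proof.
refine (@MkDoubleCat (dob C) (vert C) (hor C) (@gamma_sq C)
  (fun a b h => exist _ (vid C h) (generated_globular (vid C h)))
  (fun a b c d a' b' h k l f g f' g' x y =>
     exist _ (vcomp C (proj1_sig x) (proj1_sig y))
       (generated_vcomp (proj2_sig x) (proj2_sig y)))
  (fun a c f => exist _ (hunit C f) (generated_unit f))
  (fun a b c d e i h k h' k' f g j x y =>
     exist _ (hcomp C (proj1_sig x) (proj1_sig y))
       (generated_hcomp (proj2_sig x) (proj2_sig y)))
  _ _ _ _ _ _ _ _ _ _).
- intros a b c d h k f g [x px]; apply gamma_sq_pack, vcomp_idl.
- intros a b c d h k f g [x px]; apply gamma_sq_pack, vcomp_idr.
- intros; apply gamma_sq_pack, vcompA.
- intros; apply gamma_sq_eq, hunit_id.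
- intros; apply gamma_sq_eq, hunit_comp.
- intros; apply gamma_sq_eq, hcomp_vid.
- intros; apply gamma_sq_eq, interchange.
- intros a b c d h k f g [x px]; apply gamma_sq_pack, hcomp_idl.
- intros a b c d h k f g [x px]; apply gamma_sq_pack, hcomp_idr.
- intros; apply gamma_sq_pack, hcompA.
Defined.

(* [V_from_1 n] is V^{n+1} in the usual numbering, which starts at 1. *)
Fixpoint V_from_1 (D : DoubleCat) (n : nat) : SqPred D :=
  match n with
  | 0 => vclosure (@generator D)
  | S m => vclosure (hclosure (V_from_1 (D := D) m))
  end.

Definition Vk (D : DoubleCat) (k : nat) : SqPred D := V_from_1 (D := D) (k - 1).

(* (gamma C)_1 = V^k_(gamma C) *)
Definition exhausted_at (C : DoubleCat) (k : nat) : Prop :=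
  forall a b c d (h : hom (hor (gamma C)) a b) (l : hom (hor (gamma C)) c d)
    (f : hom (vert (gamma C)) a c) (g : hom (vert (gamma C)) b d)
    (x : sq (gamma C) h l f g), Vk k x.

(* Lengths are elements of N u {oo}, with [None] for oo. *)
Definition is_length (C : DoubleCat) (l : option nat) : Prop :=
  match l with
  | Some k => 1 <= k /\ exhausted_at C k
              /\ forall j, 1 <= j -> exhausted_at C j -> k <= j
  | None => forall j, 1 <= j -> ~ exhausted_at C j
  end.

(* Main.v *)
Require Import Defs.
From Stdlib Require Import ProofIrrelevance FunctionalExtensionality
  PropExtensionality ClassicalEpsilon.

(** Let [V] be the vertical category and [B] the 2-category.  Write composites
    in diagrammatic order.

    If every square is a vertical composite of 2-cells and unit squares, then a
    square with non-identity frames begins with a 2-cell ending at a horizontal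
    identity, crosses a vertical morphism, and ends with a 2-cell starting at a
    horizontal identity.  What it meets in between is a chain
    U(f), x, U(g), ..., with x in some pi_2, and an indexing Phi is exactly a
    rule for moving such scalars downwards: x ; U(g) = U(g) ; Phi(g)(x).  Hence
    the square reduces to a bridge (p, f, s), with p : h => 1, a vertical f
    which is both its left and its right frame, and s : 1 => k, standing for
    p ; U(f) ; s.  Two bridges must agree when they differ by sliding a scalar,
    (p ; x, f, s) = (p, f, Phi(f)(x) ; s), and a bridge over an identity must
    agree with the 2-cell p ; s.  So the squares are

    - the 2-cells h => k, when both frames are identities;
    - otherwise the bridges modulo sliding, that is, the elements of
      B(h, 1) x B(1, k) balanced over pi_2, which exist only when the two
      frames coincide.

    Bridges are stacked by (p, f, s) ; (p', g, s') = (p, fg, Phi(g)(s ; p') ; s')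
    and juxtaposed componentwise.  Functoriality of Phi gives vertical
    associativity; multiplicativity of Phi and the Eckmann-Hilton identity on
    pi_2 give the interchange law.

    A composite fg of non-identities may be an identity, so the two kinds of
    squares cannot be composed separately.  The laws are therefore proved for
    presquares, in which 2-cells and bridges over arbitrary [f] are kept apart,
    up to the congruence [sim] generated by sliding and by fusing a bridge over
    an identity ([prevcompA], [prehcompA], [preinterchange]).  The one fact that
    makes the globular squares come out right is that [sim] identifies no two
    2-cells: composing p with s is well defined on [sim]-classes ([value_sim]).
    Choosing the 2-cells themselves to be the squares with identity frames then
    makes the horizontal 2-category equal to [B], and not just isomorphic to it
    ([horizontalization_semidirect], through [TwoCat_ext]).  Length one holds
    because a bridge is p ; U(f) ; s ([semidirect_vgenerated], [length_one]).

    An opindexing is an indexing for the vertical opposite of the decorated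
    2-category, so its double category is the vertical opposite of the one
    above ([vopDouble], [indexing_vop]). *)

Set Implicit Arguments.
Unset Strict Implicit.

(** * Cells of a 2-category up to equality of their boundaries *)

Section Cells.
Variables (ob : Type) (B : TwoCat ob).

Local Notation cell := (hom (cells2 B _ _)).
Local Notation one := (idm (cells1 B)).
Local Notation "h @ k" := (comp (cells1 B) h k) (at level 38, left associativity).
Local Notation "x ;; y" := (comp (cells2 B _ _) x y) (at level 42, left associativity).
Local Notation "x ** y" := (hcomp2 B x y) (at level 40, left associativity).
Local Notation "x ~= y" := (cell_pack x = cell_pack y) (at level 70).

(** Packing a 2-cell with its boundary turns the strict laws of [B], which hold
    across propositionally equal boundaries, into equations; the next two lemmas
    allow rewriting with them inside a composite. *)
Lemma pack_vcomp a b (h k l h' k' l' : hom (cells1 B) a b)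
    (x : cell h k) (y : cell k l) (x' : cell h' k') (y' : cell k' l') :
  x ~= x' -> y ~= y' -> x ;; y ~= x' ;; y'.
Proof.
intros E F.
assert (Eh : h = h') by exact (f_equal (fun s => fst (projT1 s)) E).
assert (Ek : k = k') by exact (f_equal (fun s => snd (projT1 s)) E).
assert (El : l = l') by exact (f_equal (fun s => snd (projT1 s)) F).
destruct Eh, Ek, El.
apply (cell_pack_inj (cell := cell)) in E; apply (cell_pack_inj (cell := cell)) in F.
destruct E, F; reflexivity.
Qed.

Lemma pack_hcomp a b c (h k h' k' : hom (cells1 B) a b) (l m l' m' : hom (cells1 B) b c)
    (x : cell h k) (y : cell l m) (x' : cell h' k') (y' : cell l' m') :
  x ~= x' -> y ~= y' -> x ** y ~= x' ** y'.
Proof.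
intros E F.
assert (Eh : h = h') by exact (f_equal (fun s => fst (projT1 s)) E).
assert (Ek : k = k') by exact (f_equal (fun s => snd (projT1 s)) E).
assert (El : l = l') by exact (f_equal (fun s => fst (projT1 s)) F).
assert (Em : m = m') by exact (f_equal (fun s => snd (projT1 s)) F).
destruct Eh, Ek, El, Em.
apply (cell_pack_inj (cell := cell)) in E; apply (cell_pack_inj (cell := cell)) in F.
destruct E, F; reflexivity.
Qed.

Lemma pack_cast a b (h h' k k' : hom (cells1 B) a b) (eh : h = h') (ek : k = k')
    (x : cell h k) : cast2 eh ek x ~= x.
Proof. apply cell_pack_cast2. Qed.

(** The juxtaposition of two 2-cells ending at [one a] ends at [one a @ one a];
    the cast brings it back to [one a]. *)
Definition bridge_top a (h h' : hom (cells1 B) a a)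
    (p : cell h (one a)) (p' : cell h' (one a)) : cell (h @ h') (one a) :=
  cast2 eq_refl (comp_idl (cells1 B) (one a)) (p ** p').

Definition bridge_bot a (k k' : hom (cells1 B) a a)
    (s : cell (one a) k) (s' : cell (one a) k') : cell (one a) (k @ k') :=
  cast2 (comp_idl (cells1 B) (one a)) eq_refl (s ** s').

(** One half of the Eckmann-Hilton argument. *)
Lemma hcomp_pi2 a (x y : cell (one a) (one a)) : x ** y ~= x ;; y.
Proof.
transitivity (cell_pack ((x ;; idm _ (one a)) ** (idm _ (one a) ;; y))).
- rewrite (comp_idl (cells2 B a a) y), (comp_idr (cells2 B a a) x); reflexivity.
- rewrite hcomp2_comp; apply pack_vcomp; [apply hcomp2_idr | apply hcomp2_idl].
Qed.

(** With [bridge_bot_scale], this says that scalars of [pi2] attached to two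
    juxtaposed bridges can be collected into one; the congruence [sim] is
    compatible with horizontal composition for this reason. *)
Lemma bridge_top_scale a (h h' : hom (cells1 B) a a)
    (p : cell h (one a)) (p' : cell h' (one a)) (x x' : cell (one a) (one a)) :
  bridge_top (p ;; x) (p' ;; x') = bridge_top p p' ;; (x ;; x').
Proof.
apply (cell_pack_inj (cell := cell)); unfold bridge_top.
rewrite pack_cast, hcomp2_comp.
apply pack_vcomp; [symmetry; apply pack_cast | apply hcomp_pi2].
Qed.

Lemma bridge_bot_scale a (k k' : hom (cells1 B) a a)
    (x x' : cell (one a) (one a)) (s : cell (one a) k) (s' : cell (one a) k') :
  bridge_bot (x ;; s) (x' ;; s') = (x ;; x') ;; bridge_bot s s'.
Proof.
apply (cell_pack_inj (cell := cell)); unfold bridge_bot.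
rewrite pack_cast, hcomp2_comp.
apply pack_vcomp; [apply hcomp_pi2 | symmetry; apply pack_cast].
Qed.

Lemma bridge_top_act a (h h' k k' : hom (cells1 B) a a)
    (x : cell h k) (x' : cell h' k') (p : cell k (one a)) (p' : cell k' (one a)) :
  bridge_top (x ;; p) (x' ;; p') = (x ** x') ;; bridge_top p p'.
Proof.
apply (cell_pack_inj (cell := cell)); unfold bridge_top.
rewrite pack_cast, hcomp2_comp.
apply pack_vcomp; [reflexivity | symmetry; apply pack_cast].
Qed.

Lemma bridge_bot_act a (h h' k k' : hom (cells1 B) a a)
    (s : cell (one a) h) (s' : cell (one a) h') (x : cell h k) (x' : cell h' k') :
  bridge_bot (s ;; x) (s' ;; x') = bridge_bot s s' ;; (x ** x').
Proof.
apply (cell_pack_inj (cell := cell)); unfold bridge_bot.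
rewrite pack_cast, hcomp2_comp.
apply pack_vcomp; [symmetry; apply pack_cast | reflexivity].
Qed.

Lemma bridge_top_bot a (h h' k k' : hom (cells1 B) a a)
    (p : cell h (one a)) (p' : cell h' (one a))
    (s : cell (one a) k) (s' : cell (one a) k') :
  bridge_top p p' ;; bridge_bot s s' = (p ;; s) ** (p' ;; s').
Proof.
apply (cell_pack_inj (cell := cell)); unfold bridge_top, bridge_bot.
rewrite hcomp2_comp; apply pack_vcomp; apply pack_cast.
Qed.

(** The middle of two stacked rows of bridges: the scalar met by the whole row is
    the product of the scalars met by its members.  Interchange rests on this. *)
Lemma bridge_bot_top a (k k' : hom (cells1 B) a a)
    (s : cell (one a) k) (s' : cell (one a) k')
    (p : cell k (one a)) (p' : cell k' (one a)) :
  bridge_bot s s' ;; bridge_top p p' = (s ;; p) ;; (s' ;; p').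
Proof.
apply (cell_pack_inj (cell := cell)); rewrite <- hcomp_pi2, hcomp2_comp.
unfold bridge_top, bridge_bot; apply pack_vcomp; apply pack_cast.
Qed.

Lemma bridge_top_idl a (h : hom (cells1 B) a a) (p : cell h (one a)) :
  bridge_top (idm _ (one a)) p ~= p.
Proof. unfold bridge_top; rewrite pack_cast; apply hcomp2_idl. Qed.

Lemma bridge_top_idr a (h : hom (cells1 B) a a) (p : cell h (one a)) :
  bridge_top p (idm _ (one a)) ~= p.
Proof. unfold bridge_top; rewrite pack_cast; apply hcomp2_idr. Qed.

Lemma bridge_bot_idl a (k : hom (cells1 B) a a) (s : cell (one a) k) :
  bridge_bot (idm _ (one a)) s ~= s.
Proof. unfold bridge_bot; rewrite pack_cast; apply hcomp2_idl. Qed.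

Lemma bridge_bot_idr a (k : hom (cells1 B) a a) (s : cell (one a) k) :
  bridge_bot s (idm _ (one a)) ~= s.
Proof. unfold bridge_bot; rewrite pack_cast; apply hcomp2_idr. Qed.

Lemma bridge_topA a (h h' h'' : hom (cells1 B) a a)
    (p : cell h (one a)) (p' : cell h' (one a)) (p'' : cell h'' (one a)) :
  bridge_top p (bridge_top p' p'') ~= bridge_top (bridge_top p p') p''.
Proof.
unfold bridge_top; rewrite !pack_cast.
transitivity (cell_pack (p ** (p' ** p''))).
- apply pack_hcomp; [reflexivity | apply pack_cast].
- rewrite hcomp2A; apply pack_hcomp; [symmetry; apply pack_cast | reflexivity].
Qed.

Lemma bridge_botA a (k k' k'' : hom (cells1 B) a a)
    (s : cell (one a) k) (s' : cell (one a) k') (s'' : cell (one a) k'') :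
  bridge_bot s (bridge_bot s' s'') ~= bridge_bot (bridge_bot s s') s''.
Proof.
unfold bridge_bot; rewrite !pack_cast.
transitivity (cell_pack (s ** (s' ** s''))).
- apply pack_hcomp; [reflexivity | apply pack_cast].
- rewrite hcomp2A; apply pack_hcomp; [symmetry; apply pack_cast | reflexivity].
Qed.

End Cells.

(** * Equality of 2-categories *)

Definition coerce (X Y : Type) (E : X = Y) (x : X) : Y :=
  match E in _ = Z return Z with eq_refl => x end.

(** A variable record does not compute to its components, so a family of categories is replaced
    by a family of explicit records before its components are compared. *)
Lemma cat_family_eta I J (X : I -> J -> Type) (A : forall i j, Cat (X i j)) :
  exists F id c l r s, A = fun i j => @MkCat _ (F i j) (id i j) (c i j) (l i j) (r i j) (s i j).
Proof.
exists (fun i j => @hom _ (A i j)), (fun i j => @idm _ (A i j)), (fun i j => @comp _ (A i j)),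
  (fun i j => @comp_idl _ (A i j)), (fun i j => @comp_idr _ (A i j)),
  (fun i j => @compA _ (A i j)).
apply functional_extensionality_dep; intro i.
apply functional_extensionality_dep; intro j; destruct (A i j); reflexivity.
Qed.

(** The hom-types are only assumed equal, not convertible, because the squares
    with identity frames will be given by a case distinction that reduces
    propositionally.  Once the equalities are made trivial by proof irrelevance,
    the operations agree by extensionality and the laws are propositions. *)
Lemma TwoCat_ext ob (T : TwoCat ob) c2 hc l1 l2 l3 l4 l5
    (E : forall a b (h k : hom (cells1 T) a b), hom (cells2 T a b) h k = hom (c2 a b) h k) :
  (forall a b (h : hom (cells1 T) a b), coerce (E a b h h) (idm _ h) = idm _ h) ->
  (forall a b (h k l : hom (cells1 T) a b) (x : hom (cells2 T a b) h k)
     (y : hom (cells2 T a b) k l),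
     coerce (E a b h l) (comp _ x y) = comp _ (coerce (E a b h k) x) (coerce (E a b k l) y)) ->
  (forall a b c (h h' : hom (cells1 T) a b) (k k' : hom (cells1 T) b c)
     (x : hom (cells2 T a b) h h') (y : hom (cells2 T b c) k k'),
     coerce (E a c _ _) (hcomp2 T x y)
     = hc a b c h h' k k' (coerce (E a b h h') x) (coerce (E b c k k') y)) ->
  T = @MkTwoCat ob (cells1 T) c2 hc l1 l2 l3 l4 l5.
Proof.
destruct T as [H c2' hc' m1 m2 m3 m4 m5]; cbn [cells1 cells2 hcomp2] in *.
destruct (cat_family_eta c2) as [F [i [c [p1 [p2 [p3 ->]]]]]].
destruct (cat_family_eta c2') as [F' [i' [c' [p1' [p2' [p3' ->]]]]]].
cbn in *.
assert (EF : F' = F).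
{ do 4 (apply functional_extensionality_dep; intro); apply E. }
destruct EF.
assert (Ec : forall a b h k x, coerce (E a b h k) x = x).
{ intros; rewrite (proof_irrelevance _ (E a b h k) eq_refl); reflexivity. }
intros Ei Em Eh.
assert (Fi : i' = i).
{ do 3 (apply functional_extensionality_dep; intro); rewrite <- Ei; symmetry; apply Ec. }
assert (Fm : c' = c).
{ do 7 (apply functional_extensionality_dep; intro).
  specialize (Em x x0 x1 x2 x3 x4 x5); rewrite !Ec in Em; exact Em. }
destruct Fi, Fm.
destruct (proof_irrelevance _ p1 p1'), (proof_irrelevance _ p2 p2'),
  (proof_irrelevance _ p3 p3').
assert (Fh : hc' = hc).
{ do 9 (apply functional_extensionality_dep; intro).
  specialize (Eh x x0 x1 x2 x3 x4 x5 x6 x7); rewrite !Ec in Eh; exact Eh. }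
destruct Fh; f_equal; apply proof_irrelevance.
Qed.

(** * Squares generated vertically, and length *)

Lemma vclosure_pack (C : DoubleCat) (P : SqPred C) a b c d
    (h h' : hom (hor C) a b) (k k' : hom (hor C) c d) (f f' : hom (vert C) a c)
    (g g' : hom (vert C) b d) (x : sq C h k f g) (y : sq C h' k' f' g') :
  sq_pack (S := @sq C) x = sq_pack y -> vclosure P x -> vclosure P y.
Proof.
intros E X.
exact (eq_ind (sq_pack (S := @sq C) x) (fun w => vclosure P (projT2 w)) X _ E).
Qed.

Lemma vclosure_generated (C : DoubleCat) a b c d (h : hom (hor C) a b)
    (k : hom (hor C) c d) f g (x : sq C h k f g) :
  vclosure (@generator C) x -> generated x.
Proof.
induction 1.
- apply generated_base; assumption.
- apply generated_globular.
- apply generated_vcomp; assumption.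
Qed.

(** A stack of generators of [C] is also one in [gamma C], whatever derivation
    certifies that the total square is generated. *)
Lemma vclosure_gamma (C : DoubleCat) a b c d (h : hom (hor C) a b)
    (k : hom (hor C) c d) f g (x : sq C h k f g) :
  vclosure (@generator C) x -> forall px : generated x,
  vclosure (@generator (gamma C)) (exist _ x px : sq (gamma C) h k f g).
Proof.
induction 1 as [a b c d h k f g x G | a b h |
  a b c d a' b' h k l f g f' g' x y X IHx Y IHy]; intro px.
- apply vclosure_base; destruct G.
  + apply (generator_globular (C := gamma C)).
  + rewrite (proof_irrelevance _ px (generated_unit f)).
    apply (generator_unit (C := gamma C)).
- rewrite (proof_irrelevance _ px (generated_globular (vid C h))).
  apply (vclosure_id (C := gamma C)).
- pose (gx := vclosure_generated X); pose (gy := vclosure_generated Y).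
  rewrite (proof_irrelevance _ px (generated_vcomp gx gy)).
  exact (vclosure_comp (C := gamma C) (IHx gx) (IHy gy)).
Qed.

(** One is the least admissible length, so it suffices that the first stage of the
    filtration is everything. *)
Lemma length_one (C : DoubleCat) :
  (forall a b c d (h : hom (hor C) a b) (k : hom (hor C) c d) f g (x : sq C h k f g),
     vclosure (@generator C) x) ->
  is_length C (Some 1).
Proof.
intro G; split; [apply le_n | split].
- intros a b c d h l f g [x px]; apply (vclosure_gamma (G _ _ _ _ _ _ _ _ x)).
- intros j Hj _; exact Hj.
Qed.

(** * Presquares and their composites *)

(** Moves data between two proofs of one proposition.  It is applied to loops
    [e : a = a], which arise when both squares in a composite constrain the same
    objects. *)
Definition irr_cast (A : Prop) (P : A -> Type) (p q : A) (x : P p) : P q :=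
  eq_rect p P x q (proof_irrelevance A p q).

Lemma irr_cast_id (A : Prop) (P : A -> Type) (p : A) (x : P p) : irr_cast p x = x.
Proof.
unfold irr_cast; rewrite (proof_irrelevance _ (proof_irrelevance A p p) eq_refl).
reflexivity.
Qed.

(** The identity of [a], for an [a] known under two names. *)
Definition one_along ob (A : Cat ob) (a b : ob) (e : a = b) : hom A a b :=
  match e with eq_refl => idm A a end.

Definition hom_along ob (A : Cat ob) (a b c d : ob) (ac : a = c) (bd : b = d)
    (f : hom A a b) : hom A c d :=
  match ac, bd with eq_refl, eq_refl => f end.

(** Eliminates equations between objects or morphisms as soon as a side is a
    variable, and replaces loops by [eq_refl]. *)
Ltac clean_eqs :=
  repeat (cbn [one_along hom_along] in *; match goal with
  | e : ?x = ?x |- _ => is_var e;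
      pose proof (proof_irrelevance _ e eq_refl); subst e
  | e : ?x = ?y |- _ => is_var e; first [is_var y; destruct e | is_var x; subst x]
  end); cbn [one_along hom_along] in *.

Section Presquares.
Variables (ob : Type) (V : Cat ob) (B : TwoCat ob).
Variable act : forall a c, hom V a c -> carrier (pi2 B a) -> carrier (pi2 B c).
Hypothesis act_id : forall a x, act (idm V a) x = x.
Hypothesis act_comp : forall a b c (f : hom V a b) (g : hom V b c) x,
  act (comp V f g) x = act g (act f x).
Hypothesis act1 : forall a c (f : hom V a c), act f (mone (pi2 B a)) = mone (pi2 B c).
Hypothesis actM : forall a c (f : hom V a c) x y,
  act f (mmul x y) = mmul (act f x) (act f y).

Local Notation H := (cells1 B).
Local Notation cell := (hom (cells2 B _ _)).
Local Notation one := (idm (cells1 B)).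
Local Notation "h @ k" := (comp (cells1 B) h k) (at level 38, left associativity).
Local Notation "x ;; y" := (comp (cells2 B _ _) x y) (at level 42, left associativity).
Local Notation "x ** y" := (hcomp2 B x y) (at level 40, left associativity).
Local Notation "x ~= y" := (cell_pack x = cell_pack y) (at level 70).

Lemma act_vcomp a c (f : hom V a c) (x y : cell (one a) (one a)) :
  act f (x ;; y) = act f x ;; act f y.
Proof. exact (actM f x y). Qed.

(** The frames are constrained by equations carried as data rather than by
    indices, so that a presquare can be split into cases although its frames are
    not variables, as happens to neighbours sharing a frame.  [Bridge p s]
    stands for the vertical composite of [p], the unit square of [f], and [s]. *)
Inductive presq a b c d (h : hom H a b) (k : hom H c d)
    (f : hom V a c) (g : hom V b d) : Type :=
| Glob (ac : a = c) (bd : b = d) (ef : one_along V ac = f) (eg : one_along V bd = g)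
    (x : cell (hom_along ac bd h) k)
| Bridge (ab : a = b) (cd : c = d) (fg : hom_along ab cd f = g)
    (p : cell h (one_along H ab)) (s : cell (one_along H cd) k).

Definition glob a b (h k : hom H a b) (x : cell h k) :
    presq h k (idm V a) (idm V b) :=
  @Glob a b a b h k (idm V a) (idm V b) eq_refl eq_refl eq_refl eq_refl x.

Definition bridge a c (f : hom V a c) (h : hom H a a) (k : hom H c c)
    (p : cell h (one a)) (s : cell (one c) k) : presq h k f f :=
  @Bridge a a c c h k f f eq_refl eq_refl eq_refl p s.

Local Notation pack x := (sq_pack (S := presq) x).

Definition precast a b c d (h : hom H a b) (k : hom H c d)
    (f f' : hom V a c) (g g' : hom V b d) (ef : f = f') (eg : g = g')
    (x : presq h k f g) : presq h k f' g' :=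
  match ef in _ = u, eg in _ = v return presq h k u v with
  | eq_refl, eq_refl => x
  end.

Lemma pack_precast a b c d (h : hom H a b) (k : hom H c d)
    (f f' : hom V a c) (g g' : hom V b d) (ef : f = f') (eg : g = g')
    (x : presq h k f g) : pack (precast ef eg x) = pack x.
Proof. destruct ef, eg; reflexivity. Qed.

(** Composition with a 2-cell on top ([lglob]) and below ([rglob]).  These keep
    the frames, so their laws are equations; vertical composition with a globular
    presquare is one of them up to the frame equations [id ; f = f] and
    [f ; id = f]. *)
Definition lglob a b c d (h h' : hom H a b) (k : hom H c d) (f : hom V a c)
    (g : hom V b d) (x : cell h h') (y : presq h' k f g) : presq h k f g.
Proof.
destruct y as [ac bd ef eg y | ab cd fg p s].
- apply (Glob ef eg); destruct ac, bd; exact (x ;; y).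
- exact (Bridge fg (x ;; p) s).
Defined.

Definition rglob a b c d (h : hom H a b) (k k' : hom H c d) (f : hom V a c)
    (g : hom V b d) (y : presq h k f g) (x : cell k k') : presq h k' f g :=
  match y with
  | Glob ef eg y => Glob ef eg (y ;; x)
  | Bridge fg p s => Bridge fg p (s ;; x)
  end.

Lemma bridge_frames (a b c : ob) (f : hom V a b) (f' : hom V b c)
    (e : b = b) (g' : hom V b c) :
  hom_along e eq_refl f' = g' -> comp V f f' = comp V f g'.
Proof. clean_eqs; intro E; destruct E; reflexivity. Qed.

(** When two bridges are stacked, the scalar [s ;; p'] in the middle is moved below
    the second vertical morphism by [act]. *)
Definition prevcomp a b c d a' b' (h : hom H a b) (k : hom H c d)
    (l : hom H a' b') (f : hom V a c) (g : hom V b d)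
    (f' : hom V c a') (g' : hom V d b')
    (x : presq h k f g) (y : presq k l f' g') :
    presq h l (comp V f f') (comp V g g').
Proof.
destruct x as [ac bd ef eg x | ab cd fg p s].
- destruct ac, bd, ef, eg.
  exact (precast (eq_sym (comp_idl V f')) (eq_sym (comp_idl V g')) (lglob x y)).
- destruct y as [ac bd ef eg y | cd' ab' fg' p' s'].
  + destruct ac, bd, ef, eg.
    exact (precast (eq_sym (comp_idr V f)) (eq_sym (comp_idr V g))
             (Bridge fg p (s ;; y))).
  + destruct cd, ab, fg, ab'.
    refine (@Bridge _ _ _ _ _ _ _ _ eq_refl eq_refl _ p
      (act f' (s ;; irr_cast (P := fun e => cell k (one_along H e)) eq_refl p') ;; s')).
    exact (bridge_frames f fg').
Defined.

(** If one of two juxtaposed presquares is globular, the shared frame is an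
    identity, hence so are all frames; a bridge beside it is then a bridge over an
    identity and can be evaluated to a 2-cell. *)
Definition prehcomp a b c d e i (h : hom H a b) (k : hom H c d)
    (h' : hom H b e) (k' : hom H d i)
    (f : hom V a c) (g : hom V b d) (j : hom V e i)
    (x : presq h k f g) (x' : presq h' k' g j) : presq (h @ h') (k @ k') f j.
Proof.
destruct x as [ac bd ef eg x | ab cd fg p s];
destruct x' as [ac' bd' ef' eg' x' | ab' cd' fg' p' s'].
- destruct ac, bd, ef, eg, bd', eg'.
  exact (glob (x ** irr_cast (P := fun u => cell (hom_along u eq_refl h') k')
                      eq_refl x')).
- destruct ac, bd, ef, eg, ab', cd', fg'; exact (glob (x ** (p' ;; s'))).
- destruct ab, cd, fg, ac', bd'; cbn in ef'; destruct ef', eg'; exact (glob ((p ;; s) ** x')).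
- destruct ab, cd, fg, ab', cd', fg'.
  exact (bridge f (bridge_top p p') (bridge_bot s s')).
Defined.

Ltac fold_squares :=
  repeat match goal with
  | |- context [@Glob ?a ?b _ _ ?h ?k _ _ eq_refl eq_refl eq_refl eq_refl ?w] =>
      change (@Glob a b a b h k (idm V a) (idm V b) eq_refl eq_refl eq_refl eq_refl w)
        with (glob w)
  | |- context [@Bridge ?a _ ?c _ ?h ?k ?f _ eq_refl eq_refl eq_refl ?v ?w] =>
      change (@Bridge a a c c h k f f eq_refl eq_refl eq_refl v w)
        with (bridge f v w)
  end.

(** Splits a presquare into its two kinds, solves the frame equations and displays
    the result with [glob] and [bridge]. *)
Ltac casesq x :=
  let ac := fresh "ac" in let bd := fresh "bd" in
  let ef := fresh "ef" in let eg := fresh "eg" in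
  let ab := fresh "ab" in let cd := fresh "cd" in
  let fg := fresh "fg" in
  let u := fresh "u" in let p := fresh "p" in let s := fresh "s" in
  destruct x as [ac bd ef eg u | ab cd fg p s]; clean_eqs;
  fold_squares.

Lemma prevcomp_globl a b c d (h h' : hom H a b) (k : hom H c d) (f : hom V a c)
    (g : hom V b d) (x : cell h h') (y : presq h' k f g) :
  prevcomp (glob x) y
  = precast (eq_sym (comp_idl V f)) (eq_sym (comp_idl V g)) (lglob x y).
Proof. reflexivity. Qed.

Lemma prevcomp_globr a b c d (h : hom H a b) (k k' : hom H c d) (f : hom V a c)
    (g : hom V b d) (y : presq h k f g) (x : cell k k') :
  prevcomp y (glob x)
  = precast (eq_sym (comp_idr V f)) (eq_sym (comp_idr V g)) (rglob y x).
Proof.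
casesq y.
- cbn. f_equal; apply proof_irrelevance.
- reflexivity.
Qed.

Lemma prevcomp_bridge a c e (f : hom V a c) (f' : hom V c e) (h : hom H a a)
    (k : hom H c c) (l : hom H e e) (p : cell h (one a)) (s : cell (one c) k)
    (p' : cell k (one c)) (s' : cell (one e) l) :
  prevcomp (bridge f p s) (bridge f' p' s')
  = bridge (comp V f f') p (act f' (s ;; p') ;; s').
Proof.
cbn. unfold bridge. rewrite irr_cast_id. f_equal; apply proof_irrelevance.
Qed.

Lemma prehcomp_gg a b c (h k : hom H a b) (h' k' : hom H b c)
    (x : cell h k) (x' : cell h' k') :
  prehcomp (glob x) (glob x') = glob (x ** x').
Proof. cbn; rewrite irr_cast_id; reflexivity. Qed.

Lemma prehcomp_gb a b (h k : hom H a b) (h' k' : hom H b b)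
    (x : cell h k) (p : cell h' (one b)) (s : cell (one b) k') :
  prehcomp (glob x) (bridge (idm V b) p s) = glob (x ** (p ;; s)).
Proof. reflexivity. Qed.

Lemma prehcomp_bg a b (h k : hom H a a) (h' k' : hom H a b)
    (x : cell h' k') (p : cell h (one a)) (s : cell (one a) k) :
  prehcomp (bridge (idm V a) p s) (glob x) = glob ((p ;; s) ** x).
Proof. reflexivity. Qed.

Lemma prehcomp_bb a c (f : hom V a c) (h h' : hom H a a) (k k' : hom H c c)
    (p : cell h (one a)) (s : cell (one c) k)
    (p' : cell h' (one a)) (s' : cell (one c) k') :
  prehcomp (bridge f p s) (bridge f p' s')
  = bridge f (bridge_top p p') (bridge_bot s s').
Proof. reflexivity. Qed.

(** * The congruence on presquares *)

(** Presquares that have to represent the same square. *)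
Inductive sim : forall a b c d (h : hom H a b) (k : hom H c d)
    (f : hom V a c) (g : hom V b d), presq h k f g -> presq h k f g -> Prop :=
| sim_slide a c (f : hom V a c) (h : hom H a a) (k : hom H c c)
    (p : cell h (one a)) (x : cell (one a) (one a)) (s : cell (one c) k) :
    sim (bridge f (p ;; x) s) (bridge f p (act f x ;; s))
| sim_fuse a (h k : hom H a a) (p : cell h (one a)) (s : cell (one a) k) :
    sim (bridge (idm V a) p s) (glob (p ;; s))
| sim_refl a b c d (h : hom H a b) (k : hom H c d) f g (x : presq h k f g) : sim x x
| sim_sym a b c d (h : hom H a b) (k : hom H c d) f g (x y : presq h k f g) :
    sim x y -> sim y x
| sim_trans a b c d (h : hom H a b) (k : hom H c d) f g (x y z : presq h k f g) :
    sim x y -> sim y z -> sim x z.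

Lemma sim_eq a b c d (h : hom H a b) (k : hom H c d) f g (x y : presq h k f g) :
  x = y -> sim x y.
Proof. intro E; destruct E; apply sim_refl. Qed.

Lemma sim_precast a b c d (h : hom H a b) (k : hom H c d)
    (f f' : hom V a c) (g g' : hom V b d) (ef : f = f') (eg : g = g')
    (x y : presq h k f g) : sim x y -> sim (precast ef eg x) (precast ef eg y).
Proof. destruct ef, eg; trivial. Qed.

Lemma precast_bridge a c (f f' : hom V a c) (e e' : f = f') (h : hom H a a)
    (k : hom H c c) (p : cell h (one a)) (s : cell (one c) k) :
  precast e e' (bridge f p s) = bridge f' p s.
Proof. destruct e; clean_eqs; reflexivity. Qed.

Lemma sim_lglob a b c d (h h' : hom H a b) (k : hom H c d) (f : hom V a c)
    (g : hom V b d) (x : cell h h') (y y' : presq h' k f g) :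
  sim y y' -> sim (lglob x y) (lglob x y').
Proof.
intro S; revert h x; induction S; intros h0 x0.
- cbn. rewrite compA. apply sim_slide.
- cbn. rewrite compA. apply sim_fuse.
- apply sim_refl.
- apply sim_sym; auto.
- eapply sim_trans; eauto.
Qed.

Lemma sim_rglob a b c d (h : hom H a b) (k k' : hom H c d) (f : hom V a c)
    (g : hom V b d) (x : cell k k') (y y' : presq h k f g) :
  sim y y' -> sim (rglob y x) (rglob y' x).
Proof.
intro S; revert k' x; induction S; intros k0 x0.
- cbn. rewrite <- compA. apply sim_slide.
- cbn. rewrite <- compA. apply sim_fuse.
- apply sim_refl.
- apply sim_sym; auto.
- eapply sim_trans; eauto.
Qed.

(** Sliding above a second bridge is absorbed by functoriality of [act] on
    composites, and fusing by functoriality on identities. *)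
Lemma sim_prevcomp_l a b c d a' b' (h : hom H a b) (k : hom H c d)
    (l : hom H a' b') (f : hom V a c) (g : hom V b d)
    (f' : hom V c a') (g' : hom V d b')
    (x x' : presq h k f g) (y : presq k l f' g') :
  sim x x' -> sim (prevcomp x y) (prevcomp x' y).
Proof.
intro S; revert a' b' l f' g' y; induction S; intros a' b' l f' g' w.
- casesq w.
  + rewrite !prevcomp_globr; apply sim_precast, sim_rglob, sim_slide.
  + rewrite !prevcomp_bridge.
    eapply sim_trans; [apply sim_slide |].
    apply sim_eq; f_equal. rewrite <- !compA, act_comp, compA.
    f_equal. symmetry; apply actM.
- casesq w.
  + rewrite !prevcomp_globr; apply sim_precast, sim_rglob, sim_fuse.
  + rewrite prevcomp_globl, prevcomp_bridge.
    change (lglob (p ;; s) (bridge f' p0 s0)) with (bridge f' (p ;; s ;; p0) s0).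
    rewrite precast_bridge, <- compA; apply sim_sym.
    eapply sim_trans; [apply sim_slide |].
    apply sim_eq; rewrite act_comp, act_id; reflexivity.
- apply sim_refl.
- apply sim_sym; auto.
- eapply sim_trans; eauto.
Qed.

(** Below another bridge, both generators of [sim] become equations: the scalar
    slid past [f] is part of what the composite already moves below [f]. *)
Lemma sim_prevcomp_r a b c d a' b' (h : hom H a b) (k : hom H c d)
    (l : hom H a' b') (f : hom V a c) (g : hom V b d)
    (f' : hom V c a') (g' : hom V d b')
    (x : presq h k f g) (y y' : presq k l f' g') :
  sim y y' -> sim (prevcomp x y) (prevcomp x y').
Proof.
intro S; revert a b h f g x; induction S; intros a' b' h' f' g' w.
- casesq w.
  + rewrite !prevcomp_globl; apply sim_precast, sim_lglob, sim_slide.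
  + rewrite !prevcomp_bridge; apply sim_eq; f_equal.
    rewrite !compA; do 2 f_equal; apply actM.
- casesq w.
  + rewrite !prevcomp_globl; apply sim_precast, sim_lglob, sim_fuse.
  + rewrite prevcomp_globr, prevcomp_bridge.
    change (rglob (bridge f' p0 s0) (p ;; s)) with (bridge f' p0 (s0 ;; (p ;; s))).
    rewrite precast_bridge, compA, act_id; apply sim_refl.
- apply sim_refl.
- apply sim_sym; auto.
- eapply sim_trans; eauto.
Qed.

Lemma sim_prehcomp_l a b c d e i (h : hom H a b) (k : hom H c d)
    (h' : hom H b e) (k' : hom H d i)
    (f : hom V a c) (g : hom V b d) (j : hom V e i)
    (x y : presq h k f g) (z : presq h' k' g j) :
  sim x y -> sim (prehcomp x z) (prehcomp y z).
Proof.
intro S; revert e i h' k' j z; induction S; intros e i h' k' j w.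
- casesq w.
  + rewrite !prehcomp_bg; apply sim_eq. rewrite act_id, compA; reflexivity.
  + rewrite !prehcomp_bb.
    apply sim_trans with (bridge f (bridge_top p p0 ;; x)  (bridge_bot s s0)).
    (* The neighbour contributes the identity scalar. *)
    * rewrite <- (comp_idr _ p0) at 1. rewrite bridge_top_scale, comp_idr.
      apply sim_refl.
    * rewrite <- (comp_idl _ s0) at 2. rewrite bridge_bot_scale, comp_idr.
      apply sim_slide.
- casesq w.
  + rewrite prehcomp_bg, prehcomp_gg; apply sim_refl.
  + rewrite prehcomp_bb, prehcomp_gb, <- bridge_top_bot; apply sim_fuse.
- apply sim_refl.
- apply sim_sym; auto.
- eapply sim_trans; eauto.
Qed.

Lemma sim_prehcomp_r a b c d e i (h : hom H a b) (k : hom H c d)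
    (h' : hom H b e) (k' : hom H d i)
    (f : hom V a c) (g : hom V b d) (j : hom V e i)
    (x : presq h k f g) (y z : presq h' k' g j) :
  sim y z -> sim (prehcomp x y) (prehcomp x z).
Proof.
intro S; revert a c h k f x; induction S; intros e i h' k' j w.
- casesq w.
  + rewrite !prehcomp_gb; apply sim_eq. rewrite act_id, compA; reflexivity.
  + rewrite !prehcomp_bb.
    match goal with |- sim (bridge ?f _ _) _ =>
      apply sim_trans with (bridge f (bridge_top p0 p ;; x) (bridge_bot s0 s)) end.
    * rewrite <- (comp_idr _ p0) at 1. rewrite bridge_top_scale, comp_idl.
      apply sim_refl.
    * rewrite <- (comp_idl _ s0) at 2. rewrite bridge_bot_scale, comp_idl.
      apply sim_slide.
- casesq w.
  + rewrite prehcomp_gb, prehcomp_gg; apply sim_refl.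
  + rewrite prehcomp_bb, prehcomp_bg, <- bridge_top_bot; apply sim_fuse.
- apply sim_refl.
- apply sim_sym; auto.
- eapply sim_trans; eauto.
Qed.

(** Over identity frames each presquare is worth a 2-cell: a bridge is worth the
    composite of its halves. *)
Definition value a b c d (h : hom H a b) (k : hom H c d) (f : hom V a c)
    (g : hom V b d) (ac : a = c) (bd : b = d) (ef : one_along V ac = f)
    (eg : one_along V bd = g) (x : presq h k f g) : cell (hom_along ac bd h) k.
Proof.
destruct ac, bd, ef, eg, x as [ac bd ef eg x | ab cd fg p s].
- exact (irr_cast (P := fun u => cell (hom_along u eq_refl h) k) eq_refl
    (irr_cast (P := fun v => cell (hom_along ac v h) k) eq_refl x)).
- destruct ab; exact (p ;; irr_cast (P := fun u => cell (one_along H u) k) eq_refl s).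
Defined.

Lemma value_glob a b (h k : hom H a b) (x : cell h k) :
  value (ac := eq_refl) (bd := eq_refl) eq_refl eq_refl (glob x) = x.
Proof. cbn; rewrite !irr_cast_id; reflexivity. Qed.

Lemma value_bridge a (h k : hom H a a) (p : cell h (one a)) (s : cell (one a) k) :
  value (ac := eq_refl) (bd := eq_refl) eq_refl eq_refl (bridge (idm V a) p s) = p ;; s.
Proof. cbn; rewrite irr_cast_id; reflexivity. Qed.

(** The congruence does not collapse the 2-cells of [B].  Sliding preserves the
    value because [act] is the identity over identity frames. *)
Lemma value_sim a b c d (h : hom H a b) (k : hom H c d) (f : hom V a c)
    (g : hom V b d) (ac : a = c) (bd : b = d) (ef : one_along V ac = f)
    (eg : one_along V bd = g) (x y : presq h k f g) :
  sim x y -> value ef eg x = value ef eg y.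
Proof.
intro S; revert ac bd ef eg; induction S; intros; clean_eqs.
- rewrite !value_bridge, act_id, compA; reflexivity.
- rewrite value_bridge, value_glob; reflexivity.
- reflexivity.
- symmetry; apply (IHS eq_refl eq_refl eq_refl eq_refl).
- exact (eq_trans (IHS1 eq_refl eq_refl eq_refl eq_refl)
           (IHS2 eq_refl eq_refl eq_refl eq_refl)).
Qed.

Lemma Glob_value a b c d (h : hom H a b) (k : hom H c d) (f : hom V a c)
    (g : hom V b d) (ac : a = c) (bd : b = d) (ef : one_along V ac = f)
    (eg : one_along V bd = g) (x : presq h k f g) :
  sim (Glob ef eg (value ef eg x)) x.
Proof.
clean_eqs; casesq x.
- rewrite value_glob; apply sim_refl.
- rewrite value_bridge; apply sim_sym, sim_fuse.
Qed.

(** * The double category laws for presquares *)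

Lemma pack_glob a b (h k h' k' : hom H a b) (x : cell h k) (x' : cell h' k') :
  x ~= x' -> pack (glob x) = pack (glob x').
Proof.
intro E.
exact (f_equal (fun w : {q : hom H a b * hom H a b & cell (fst q) (snd q)} =>
  pack (glob (projT2 w))) E).
Qed.

Lemma pack_bridge a c (f : hom V a c) (h h' : hom H a a) (k k' : hom H c c)
    (p : cell h (one a)) (s : cell (one c) k)
    (p' : cell h' (one a)) (s' : cell (one c) k') :
  p ~= p' -> s ~= s' -> pack (bridge f p s) = pack (bridge f p' s').
Proof.
intros E F.
assert (Eh : h = h') by exact (f_equal (fun w => fst (projT1 w)) E).
assert (Ek : k = k') by exact (f_equal (fun w => snd (projT1 w)) F).
destruct Eh, Ek.
apply (cell_pack_inj (cell := cell)) in E; apply (cell_pack_inj (cell := cell)) in F.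
destruct E, F; reflexivity.
Qed.

Definition presq_vid a b (h : hom H a b) := glob (idm (cells2 B a b) h).

Definition presq_hunit a c (f : hom V a c) :=
  bridge f (idm (cells2 B a a) (one a)) (idm (cells2 B c c) (one c)).

Lemma lglob_id a b c d (h : hom H a b) (k : hom H c d)
    (f : hom V a c) (g : hom V b d) (x : presq h k f g) :
  lglob (idm (cells2 B a b) h) x = x.
Proof. casesq x; cbn; rewrite comp_idl; reflexivity. Qed.

Lemma rglob_id a b c d (h : hom H a b) (k : hom H c d)
    (f : hom V a c) (g : hom V b d) (x : presq h k f g) :
  rglob x (idm (cells2 B c d) k) = x.
Proof. casesq x; cbn; rewrite comp_idr; reflexivity. Qed.

Lemma prevcomp_idl a b c d (h : hom H a b) (k : hom H c d)
    (f : hom V a c) (g : hom V b d) (x : presq h k f g) :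
  pack (prevcomp (presq_vid h) x) = pack x.
Proof. unfold presq_vid; rewrite prevcomp_globl, pack_precast, lglob_id; reflexivity. Qed.

Lemma prevcomp_idr a b c d (h : hom H a b) (k : hom H c d)
    (f : hom V a c) (g : hom V b d) (x : presq h k f g) :
  pack (prevcomp x (presq_vid k)) = pack x.
Proof. unfold presq_vid; rewrite prevcomp_globr, pack_precast, rglob_id; reflexivity. Qed.

Lemma prehunit_comp a b c (f : hom V a b) (g : hom V b c) :
  presq_hunit (comp V f g) = prevcomp (presq_hunit f) (presq_hunit g).
Proof.
unfold presq_hunit; rewrite prevcomp_bridge, comp_idl, comp_idr; f_equal.
symmetry; apply act1.
Qed.

Lemma prehcomp_vid a b c (h : hom H a b) (k : hom H b c) :
  prehcomp (presq_vid h) (presq_vid k) = presq_vid (h @ k).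
Proof. unfold presq_vid; rewrite prehcomp_gg, hcomp2_id; reflexivity. Qed.

Lemma prehcomp_idl a b c d (h : hom H a b) (k : hom H c d)
    (f : hom V a c) (g : hom V b d) (x : presq h k f g) :
  pack (prehcomp (presq_hunit f) x) = pack x.
Proof.
unfold presq_hunit; casesq x.
- rewrite prehcomp_bg, (comp_idl (cells2 B _ _) (idm _ _)); apply pack_glob, hcomp2_idl.
- rewrite prehcomp_bb; apply pack_bridge; [apply bridge_top_idl | apply bridge_bot_idl].
Qed.

Lemma prehcomp_idr a b c d (h : hom H a b) (k : hom H c d)
    (f : hom V a c) (g : hom V b d) (x : presq h k f g) :
  pack (prehcomp x (presq_hunit g)) = pack x.
Proof.
unfold presq_hunit; casesq x.
- rewrite prehcomp_gb, (comp_idl (cells2 B _ _) (idm _ _)); apply pack_glob, hcomp2_idr.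
- rewrite prehcomp_bb; apply pack_bridge; [apply bridge_top_idr | apply bridge_bot_idr].
Qed.

(** As soon as one factor is globular all three are evaluated, and both sides
    reduce to associativity in [B]; otherwise it holds on each half. *)
Lemma prehcompA a0 a1 a2 a3 b0 b1 b2 b3
    (h1 : hom H a0 a1) (h2 : hom H a1 a2) (h3 : hom H a2 a3)
    (k1 : hom H b0 b1) (k2 : hom H b1 b2) (k3 : hom H b2 b3)
    (f0 : hom V a0 b0) (f1 : hom V a1 b1) (f2 : hom V a2 b2) (f3 : hom V a3 b3)
    (x : presq h1 k1 f0 f1) (y : presq h2 k2 f1 f2) (z : presq h3 k3 f2 f3) :
  pack (prehcomp x (prehcomp y z)) = pack (prehcomp (prehcomp x y) z).
Proof.
casesq x; casesq y; casesq z;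
  repeat first [rewrite prehcomp_gg | rewrite prehcomp_bg
               | rewrite prehcomp_gb | rewrite prehcomp_bb];
  try (rewrite ?bridge_top_bot; apply pack_glob, hcomp2A).
apply pack_bridge; [apply bridge_topA | apply bridge_botA].
Qed.

Lemma lglob_precast a b c d (h h' : hom H a b) (k : hom H c d)
    (f f' : hom V a c) (g g' : hom V b d) (ef : f = f') (eg : g = g')
    (x : cell h h') (y : presq h' k f g) :
  lglob x (precast ef eg y) = precast ef eg (lglob x y).
Proof. destruct ef, eg; reflexivity. Qed.

Lemma rglob_precast a b c d (h : hom H a b) (k k' : hom H c d)
    (f f' : hom V a c) (g g' : hom V b d) (ef : f = f') (eg : g = g')
    (y : presq h k f g) (x : cell k k') :
  rglob (precast ef eg y) x = precast ef eg (rglob y x).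
Proof. destruct ef, eg; reflexivity. Qed.

Lemma lglobM a b c d (h h' h'' : hom H a b) (k : hom H c d) (f : hom V a c)
    (g : hom V b d) (x : cell h h') (x' : cell h' h'') (y : presq h'' k f g) :
  lglob x (lglob x' y) = lglob (x ;; x') y.
Proof. casesq y; cbn; rewrite compA; reflexivity. Qed.

Lemma rglobM a b c d (h : hom H a b) (k k' k'' : hom H c d) (f : hom V a c)
    (g : hom V b d) (y : presq h k f g) (x : cell k k') (x' : cell k' k'') :
  rglob (rglob y x) x' = rglob y (x ;; x').
Proof. casesq y; cbn; rewrite compA; reflexivity. Qed.

Lemma lglob_rglob a b c d (h h' : hom H a b) (k k' : hom H c d) (f : hom V a c)
    (g : hom V b d) (x : cell h h') (y : presq h' k f g) (z : cell k k') :
  lglob x (rglob y z) = rglob (lglob x y) z.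
Proof. casesq y; cbn; rewrite ?compA; reflexivity. Qed.

Lemma lglob_prevcomp a b c d a' b' (h0 h : hom H a b) (k : hom H c d)
    (l : hom H a' b') (f : hom V a c) (g : hom V b d)
    (f' : hom V c a') (g' : hom V d b')
    (w : cell h0 h) (x : presq h k f g) (y : presq k l f' g') :
  lglob w (prevcomp x y) = prevcomp (lglob w x) y.
Proof.
casesq x.
- change (lglob w (glob u)) with (glob (w ;; u)).
  rewrite !prevcomp_globl, lglob_precast, lglobM; reflexivity.
- casesq y.
  + rewrite !prevcomp_globr, lglob_precast, lglob_rglob; reflexivity.
  + change (lglob w (bridge f p s)) with (bridge f (w ;; p) s).
    rewrite !prevcomp_bridge; reflexivity.
Qed.

Lemma rglob_prevcomp a b c d a' b' (h : hom H a b) (k : hom H c d)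
    (l l' : hom H a' b') (f : hom V a c) (g : hom V b d)
    (f' : hom V c a') (g' : hom V d b')
    (x : presq h k f g) (y : presq k l f' g') (w : cell l l') :
  rglob (prevcomp x y) w = prevcomp x (rglob y w).
Proof.
casesq y.
- change (rglob (glob u) w) with (glob (u ;; w)).
  rewrite !prevcomp_globr, rglob_precast, rglobM; reflexivity.
- casesq x.
  + rewrite !prevcomp_globl, rglob_precast, lglob_rglob; reflexivity.
  + change (rglob (bridge f' p s) w) with (bridge f' p (s ;; w)).
    rewrite !prevcomp_bridge; cbn; rewrite compA; reflexivity.
Qed.

Lemma prevcomp_rglob a b c d a' b' (h : hom H a b) (k k' : hom H c d)
    (l : hom H a' b') (f : hom V a c) (g : hom V b d)
    (f' : hom V c a') (g' : hom V d b')
    (x : presq h k f g) (w : cell k k') (y : presq k' l f' g') :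
  prevcomp (rglob x w) y = prevcomp x (lglob w y).
Proof.
casesq x.
- change (rglob (glob u) w) with (glob (u ;; w)).
  rewrite !prevcomp_globl, lglobM; reflexivity.
- casesq y.
  + change (lglob w (glob u)) with (glob (w ;; u)).
    rewrite !prevcomp_globr, rglobM; reflexivity.
  + change (lglob w (bridge f' p0 s0)) with (bridge f' (w ;; p0) s0).
    change (rglob (bridge f p s) w) with (bridge f p (s ;; w)).
    rewrite !prevcomp_bridge, compA; reflexivity.
Qed.

Lemma pack_prevcomp_precast_l a b c d a' b' (h : hom H a b) (k : hom H c d)
    (l : hom H a' b') (f f1 : hom V a c) (g g1 : hom V b d)
    (f' : hom V c a') (g' : hom V d b') (ef : f = f1) (eg : g = g1)
    (x : presq h k f g) (y : presq k l f' g') :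
  pack (prevcomp (precast ef eg x) y) = pack (prevcomp x y).
Proof. destruct ef, eg; reflexivity. Qed.

Lemma pack_prevcomp_precast_r a b c d a' b' (h : hom H a b) (k : hom H c d)
    (l : hom H a' b') (f : hom V a c) (g : hom V b d)
    (f' f1 : hom V c a') (g' g1 : hom V d b') (ef : f' = f1) (eg : g' = g1)
    (x : presq h k f g) (y : presq k l f' g') :
  pack (prevcomp x (precast ef eg y)) = pack (prevcomp x y).
Proof. destruct ef, eg; reflexivity. Qed.

Lemma prevcompA a b c d a' b' a'' b''
    (h : hom H a b) (k : hom H c d) (l : hom H a' b') (m : hom H a'' b'')
    (f : hom V a c) (g : hom V b d) (f' : hom V c a') (g' : hom V d b')
    (f'' : hom V a' a'') (g'' : hom V b' b'')
    (x : presq h k f g) (y : presq k l f' g') (z : presq l m f'' g'') :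
  pack (prevcomp x (prevcomp y z)) = pack (prevcomp (prevcomp x y) z).
Proof.
casesq x.
- rewrite !prevcomp_globl, pack_prevcomp_precast_l, pack_precast, lglob_prevcomp.
  reflexivity.
- casesq y.
  + rewrite prevcomp_globr, prevcomp_globl, pack_prevcomp_precast_l,
      pack_prevcomp_precast_r, prevcomp_rglob; reflexivity.
  + casesq z.
    * rewrite !prevcomp_globr, pack_prevcomp_precast_r, pack_precast, rglob_prevcomp.
      reflexivity.
    * rewrite !prevcomp_bridge, !compA.
      rewrite act_comp, <- (compA _ (act f' (s ;; p0)) s0 p1), act_vcomp; reflexivity.
Qed.

Lemma prehcomp_precast a b c d e i (h : hom H a b) (k : hom H c d)
    (h' : hom H b e) (k' : hom H d i) (f f1 : hom V a c) (g g1 : hom V b d)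
    (j j1 : hom V e i) (ef : f = f1) (eg eg' : g = g1) (ej : j = j1)
    (x : presq h k f g) (y : presq h' k' g j) :
  prehcomp (precast ef eg x) (precast eg' ej y) = precast ef ej (prehcomp x y).
Proof. destruct ef, eg, ej; clean_eqs; reflexivity. Qed.

(** Interchange for a row of 2-cells above, or below ([rglob_prehcomp]), an
    arbitrary row.  It is an equation even when the arbitrary row mixes both kinds
    of presquares. *)
Lemma lglob_prehcomp a b c d e i (h0 h : hom H a b) (k : hom H c d)
    (h0' h' : hom H b e) (k' : hom H d i)
    (f : hom V a c) (g : hom V b d) (j : hom V e i)
    (w : cell h0 h) (w' : cell h0' h') (x : presq h k f g) (x' : presq h' k' g j) :
  prehcomp (lglob w x) (lglob w' x') = lglob (w ** w') (prehcomp x x').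
Proof.
casesq x; casesq x'; cbn [lglob glob bridge]; fold_squares.
- rewrite !prehcomp_gg; cbn; rewrite hcomp2_comp; reflexivity.
- rewrite !prehcomp_gb; cbn; rewrite <- compA, hcomp2_comp; reflexivity.
- rewrite !prehcomp_bg; cbn; rewrite <- compA, hcomp2_comp; reflexivity.
- rewrite !prehcomp_bb, bridge_top_act; reflexivity.
Qed.

Lemma rglob_prehcomp a b c d e i (h : hom H a b) (k k0 : hom H c d)
    (h' : hom H b e) (k' k0' : hom H d i)
    (f : hom V a c) (g : hom V b d) (j : hom V e i)
    (x : presq h k f g) (x' : presq h' k' g j) (w : cell k k0) (w' : cell k' k0') :
  prehcomp (rglob x w) (rglob x' w') = rglob (prehcomp x x') (w ** w').
Proof.
casesq x; casesq x'; cbn [rglob glob bridge]; fold_squares.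
- rewrite !prehcomp_gg; cbn; rewrite hcomp2_comp; reflexivity.
- rewrite !prehcomp_gb; cbn; rewrite compA, hcomp2_comp; reflexivity.
- rewrite !prehcomp_bg; cbn; rewrite compA, hcomp2_comp; reflexivity.
- rewrite !prehcomp_bb, bridge_bot_act; reflexivity.
Qed.

Lemma interchange_bridge a c e (f : hom V a c) (f' : hom V c e)
    (h h' : hom H a a) (k k' : hom H c c) (l l' : hom H e e)
    (p : cell h (one a)) (s : cell (one c) k)
    (q : cell k (one c)) (t : cell (one e) l)
    (p' : cell h' (one a)) (s' : cell (one c) k')
    (q' : cell k' (one c)) (t' : cell (one e) l') :
  prehcomp (prevcomp (bridge f p s) (bridge f' q t))
           (prevcomp (bridge f p' s') (bridge f' q' t'))
  = prevcomp (prehcomp (bridge f p s) (bridge f p' s'))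
             (prehcomp (bridge f' q t) (bridge f' q' t')).
Proof.
rewrite !prevcomp_bridge, !prehcomp_bb, prevcomp_bridge.
f_equal; rewrite bridge_bot_scale, bridge_bot_top.
f_equal; symmetry; apply actM.
Qed.

Definition Interchange a b c d e i a' b' c'
    (h : hom H a b) (k : hom H d e) (l : hom H a' b')
    (h' : hom H b c) (k' : hom H e i) (l' : hom H b' c')
    (f1 : hom V a d) (f2 : hom V d a') (g1 : hom V b e) (g2 : hom V e b')
    (j1 : hom V c i) (j2 : hom V i c')
    (x : presq h k f1 g1) (y : presq k l f2 g2)
    (x' : presq h' k' g1 j1) (y' : presq k' l' g2 j2) :=
  sim (prehcomp (prevcomp x y) (prevcomp x' y'))
      (prevcomp (prehcomp x x') (prehcomp y y')).

(** Interchange need only be checked on representatives. *)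
Lemma Interchange_sim a b c d e i a' b' c'
    (h : hom H a b) (k : hom H d e) (l : hom H a' b')
    (h' : hom H b c) (k' : hom H e i) (l' : hom H b' c')
    (f1 : hom V a d) (f2 : hom V d a') (g1 : hom V b e) (g2 : hom V e b')
    (j1 : hom V c i) (j2 : hom V i c')
    (x x1 : presq h k f1 g1) (y y1 : presq k l f2 g2)
    (x' x1' : presq h' k' g1 j1) (y' y1' : presq k' l' g2 j2) :
  sim x x1 -> sim y y1 -> sim x' x1' -> sim y' y1' ->
  Interchange x1 y1 x1' y1' -> Interchange x y x' y'.
Proof.
unfold Interchange; intros X Y X' Y' I.
apply sim_trans with (prehcomp (prevcomp x1 y1) (prevcomp x1' y1')).
- eapply sim_trans; [apply sim_prehcomp_l | apply sim_prehcomp_r];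
    (eapply sim_trans; [apply sim_prevcomp_l | apply sim_prevcomp_r]; eassumption).
- apply (sim_trans I), sim_sym.
  eapply sim_trans; [apply sim_prevcomp_l | apply sim_prevcomp_r];
    (eapply sim_trans; [apply sim_prehcomp_l | apply sim_prehcomp_r]; eassumption).
Qed.

Lemma Interchange_glob_top a b c a' b' c'
    (h k : hom H a b) (l : hom H a' b') (h' k' : hom H b c) (l' : hom H b' c')
    (f : hom V a a') (g : hom V b b') (j : hom V c c')
    (x : cell h k) (y : presq k l f g) (x' : cell h' k') (y' : presq k' l' g j) :
  Interchange (glob x) y (glob x') y'.
Proof.
apply sim_eq; rewrite prehcomp_gg, !prevcomp_globl, prehcomp_precast, lglob_prehcomp.
reflexivity.
Qed.

Lemma Interchange_glob_bot a b c a' b' c'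
    (h : hom H a b) (k l : hom H a' b') (h' : hom H b c) (k' l' : hom H b' c')
    (f : hom V a a') (g : hom V b b') (j : hom V c c')
    (x : presq h k f g) (y : cell k l) (x' : presq h' k' g j) (y' : cell k' l') :
  Interchange x (glob y) x' (glob y').
Proof.
apply sim_eq; rewrite prehcomp_gg, !prevcomp_globr, prehcomp_precast, rglob_prehcomp.
reflexivity.
Qed.

(** A row that mixes a bridge and a 2-cell has identity frames, so its bridge fuses
    into a 2-cell.  This leaves rows that are globular throughout, and two rows of
    bridges. *)
Lemma preinterchange a b c d e i a' b' c'
    (h : hom H a b) (k : hom H d e) (l : hom H a' b')
    (h' : hom H b c) (k' : hom H e i) (l' : hom H b' c')
    (f1 : hom V a d) (f2 : hom V d a') (g1 : hom V b e) (g2 : hom V e b')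
    (j1 : hom V c i) (j2 : hom V i c')
    (x : presq h k f1 g1) (y : presq k l f2 g2)
    (x' : presq h' k' g1 j1) (y' : presq k' l' g2 j2) :
  Interchange x y x' y'.
Proof.
casesq x; casesq x'.
- apply Interchange_glob_top.
- eapply Interchange_sim; [apply sim_refl | apply sim_refl | apply sim_fuse
    | apply sim_refl | apply Interchange_glob_top].
- eapply Interchange_sim; [apply sim_fuse | apply sim_refl | apply sim_refl
    | apply sim_refl | apply Interchange_glob_top].
- casesq y; casesq y'.
  + apply Interchange_glob_bot.
  + eapply Interchange_sim; [apply sim_refl | apply sim_refl | apply sim_refl
      | apply sim_fuse | apply Interchange_glob_bot].
  + eapply Interchange_sim; [apply sim_refl | apply sim_fuse | apply sim_refl
      | apply sim_refl | apply Interchange_glob_bot].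
  + apply sim_eq, interchange_bridge.
Qed.

(** * Squares and the double category *)

Definition id_frames a b c d (f : hom V a c) (g : hom V b d) : Prop :=
  exists (ac : a = c) (bd : b = d), one_along V ac = f /\ one_along V bd = g.

Lemma id_frames_l a b c d (f : hom V a c) (g : hom V b d) : id_frames f g -> a = c.
Proof. intros [e _]; exact e. Qed.

Lemma id_frames_r a b c d (f : hom V a c) (g : hom V b d) : id_frames f g -> b = d.
Proof. intros [_ [e _]]; exact e. Qed.

Lemma id_frames_eql a b c d (f : hom V a c) (g : hom V b d) (i : id_frames f g) :
  one_along V (id_frames_l i) = f.
Proof.
destruct i as [ac [bd [ef eg]]].
rewrite (proof_irrelevance _ (id_frames_l _) ac); exact ef.
Qed.

Lemma id_frames_eqr a b c d (f : hom V a c) (g : hom V b d) (i : id_frames f g) :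
  one_along V (id_frames_r i) = g.
Proof.
destruct i as [ac [bd [ef eg]]].
rewrite (proof_irrelevance _ (id_frames_r _) bd); exact eg.
Qed.

(** The hom-types of [B] are used verbatim over identity frames, so that the
    horizontal 2-category will be equal to [B]; elsewhere a square is a class of
    [sim].  The decision [t] is a parameter so that it can be destructed in types. *)
Definition square_by a b c d (f : hom V a c) (g : hom V b d)
    (t : {id_frames f g} + {~ id_frames f g}) (h : hom H a b) (k : hom H c d) : Type :=
  match t with
  | left i => cell (hom_along (id_frames_l i) (id_frames_r i) h) k
  | right _ => {P : presq h k f g -> Prop | exists x, P = sim x}
  end.

Definition class_by a b c d (f : hom V a c) (g : hom V b d)
    (t : {id_frames f g} + {~ id_frames f g}) (h : hom H a b) (k : hom H c d)
    (x : presq h k f g) : square_by t h k :=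
  match t return square_by t h k with
  | left i => value (id_frames_eql i) (id_frames_eqr i) x
  | right _ => exist _ (sim x) (ex_intro _ x eq_refl)
  end.

Definition repr_by a b c d (f : hom V a c) (g : hom V b d)
    (t : {id_frames f g} + {~ id_frames f g}) (h : hom H a b) (k : hom H c d) :
    square_by t h k -> presq h k f g :=
  match t return square_by t h k -> presq h k f g with
  | left i => fun x => Glob (id_frames_eql i) (id_frames_eqr i) x
  | right _ => fun P => proj1_sig (constructive_indefinite_description _ (proj2_sig P))
  end.

Definition square : SqFamily V H := fun a b c d h k f g =>
  square_by (excluded_middle_informative (id_frames f g)) h k.

Definition class a b c d (h : hom H a b) (k : hom H c d) (f : hom V a c)
    (g : hom V b d) (x : presq h k f g) : square h k f g := class_by _ x.

Definition repr a b c d (h : hom H a b) (k : hom H c d) (f : hom V a c)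
    (g : hom V b d) (x : square h k f g) : presq h k f g := repr_by x.

Lemma value_Glob a b c d (h : hom H a b) (k : hom H c d) (f : hom V a c)
    (g : hom V b d) (ac : a = c) (bd : b = d) (ef : one_along V ac = f)
    (eg : one_along V bd = g) (x : cell (hom_along ac bd h) k) :
  value ef eg (Glob ef eg x) = x.
Proof. clean_eqs; apply value_glob. Qed.

Lemma class_repr a b c d (h : hom H a b) (k : hom H c d) (f : hom V a c)
    (g : hom V b d) (x : square h k f g) : class (repr x) = x.
Proof.
unfold class, repr; revert x; unfold square.
destruct (excluded_middle_informative (id_frames f g)) as [i | n]; cbn; intro x.
- apply value_Glob.
- destruct x as [P hP]; cbn.
  destruct (constructive_indefinite_description _ hP) as [y E]; cbn; subst P.
  f_equal; apply proof_irrelevance.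
Qed.

Lemma class_eq a b c d (h : hom H a b) (k : hom H c d) (f : hom V a c)
    (g : hom V b d) (x y : presq h k f g) : sim x y -> class x = class y.
Proof.
intro S; unfold class, square.
destruct (excluded_middle_informative (id_frames f g)) as [i | n]; cbn.
- apply value_sim, S.
- assert (E : sim x = sim y).
  { apply functional_extensionality; intro z; apply propositional_extensionality.
    split; intro Z; [exact (sim_trans (sim_sym S) Z) | exact (sim_trans S Z)]. }
  apply eq_sig_hprop; [intros; apply proof_irrelevance | exact E].
Qed.

Lemma repr_class a b c d (h : hom H a b) (k : hom H c d) (f : hom V a c)
    (g : hom V b d) (x : presq h k f g) : sim (repr (class x)) x.
Proof.
unfold class, repr, square.
destruct (excluded_middle_informative (id_frames f g)) as [i | n]; cbn.
- apply Glob_value.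
- destruct (constructive_indefinite_description _ _) as [y E]; cbn.
  rewrite <- E; apply sim_refl.
Qed.

Local Notation spack x := (sq_pack (S := square) x).

Lemma pack_class a b c d (h h' : hom H a b) (k k' : hom H c d) (f f' : hom V a c)
    (g g' : hom V b d) (x : presq h k f g) (y : presq h' k' f' g') :
  pack x = pack y -> spack (class x) = spack (class y).
Proof.
intro E.
exact (f_equal (fun w : {p : Boundary V H a b c d
    & presq (bdom p) (bcod p) (bleft p) (bright p)} => spack (class (projT2 w))) E).
Qed.

Definition square_vcomp a b c d a' b' (h : hom H a b) (k : hom H c d)
    (l : hom H a' b') (f : hom V a c) (g : hom V b d)
    (f' : hom V c a') (g' : hom V d b')
    (x : square h k f g) (y : square k l f' g') :=
  class (prevcomp (repr x) (repr y)).

Definition square_hcomp a b c d e i (h : hom H a b) (k : hom H c d)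
    (h' : hom H b e) (k' : hom H d i)
    (f : hom V a c) (g : hom V b d) (j : hom V e i)
    (x : square h k f g) (x' : square h' k' g j) :=
  class (prehcomp (repr x) (repr x')).

Lemma vcomp_class a b c d a' b' (h : hom H a b) (k : hom H c d)
    (l : hom H a' b') (f : hom V a c) (g : hom V b d)
    (f' : hom V c a') (g' : hom V d b')
    (x : presq h k f g) (y : presq k l f' g') :
  square_vcomp (class x) (class y) = class (prevcomp x y).
Proof.
apply class_eq; eapply sim_trans; [apply sim_prevcomp_l | apply sim_prevcomp_r];
  apply repr_class.
Qed.

Lemma hcomp_class a b c d e i (h : hom H a b) (k : hom H c d)
    (h' : hom H b e) (k' : hom H d i)
    (f : hom V a c) (g : hom V b d) (j : hom V e i)
    (x : presq h k f g) (x' : presq h' k' g j) :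
  square_hcomp (class x) (class x') = class (prehcomp x x').
Proof.
apply class_eq; eapply sim_trans; [apply sim_prehcomp_l | apply sim_prehcomp_r];
  apply repr_class.
Qed.

(** Every square is the class of its representative, and composites of classes are
    classes of composites, so each law is inherited from presquares. *)
Definition semidirect : DoubleCat.
Proof.
refine (@MkDoubleCat ob V H square
  (fun a b h => class (presq_vid h)) square_vcomp
  (fun a c f => class (presq_hunit f)) square_hcomp _ _ _ _ _ _ _ _ _ _).
- intros a b c d h k f g x; rewrite <- (class_repr x), vcomp_class.
  apply pack_class, prevcomp_idl.
- intros a b c d h k f g x; rewrite <- (class_repr x), vcomp_class.
  apply pack_class, prevcomp_idr.
- intros a b c d a' b' a'' b'' h k l m f g f' g' f'' g'' x y z.
  rewrite <- (class_repr x), <- (class_repr y), <- (class_repr z), !vcomp_class.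
  apply pack_class, prevcompA.
- intro a; apply class_eq. unfold presq_hunit, presq_vid.
  eapply sim_trans; [apply sim_fuse | rewrite comp_idl; apply sim_refl].
- intros a b c f g; rewrite vcomp_class, prehunit_comp; reflexivity.
- intros a b c h k; rewrite hcomp_class, prehcomp_vid; reflexivity.
- intros a b c d e i a' b' c' h k l h' k' l' f1 f2 g1 g2 j1 j2 x y x' y'.
  rewrite <- (class_repr x), <- (class_repr y), <- (class_repr x'), <- (class_repr y').
  rewrite !vcomp_class, !hcomp_class, vcomp_class; apply class_eq, preinterchange.
- intros a b c d h k f g x; rewrite <- (class_repr x), hcomp_class.
  apply pack_class, prehcomp_idl.
- intros a b c d h k f g x; rewrite <- (class_repr x), hcomp_class.
  apply pack_class, prehcomp_idr.
- intros a0 a1 a2 a3 b0 b1 b2 b3 h1 h2 h3 k1 k2 k3 f0 f1 f2 f3 x y z.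
  rewrite <- (class_repr x), <- (class_repr y), <- (class_repr z), !hcomp_class.
  apply pack_class, prehcompA.
Defined.

(** The class of [bridge f p s] is the stack of [p], the unit square of [f], and
    [s]. *)
Lemma semidirect_vgenerated a b c d (h : hom H a b) (k : hom H c d)
    (f : hom V a c) (g : hom V b d) (x : sq semidirect h k f g) :
  vclosure (@generator semidirect) x.
Proof.
change (square h k f g) in x; rewrite <- (class_repr x).
generalize (repr x) as y; clear x; intro x; casesq x.
- apply vclosure_base; apply (generator_globular (C := semidirect)).
- apply (@vclosure_pack semidirect) with
    (x := vcomp semidirect (class (glob p) : sq semidirect _ _ _ _)
            (vcomp semidirect (hunit semidirect f) (class (glob s) : sq semidirect _ _ _ _))).
  + cbn; rewrite !vcomp_class; apply pack_class.
    unfold presq_hunit.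
    rewrite prevcomp_globl, pack_precast, prevcomp_globr, lglob_precast, pack_precast.
    cbn; rewrite comp_idl, comp_idr; reflexivity.
  + apply (vclosure_comp (C := semidirect));
      [| apply (vclosure_comp (C := semidirect))]; apply vclosure_base.
    * apply (generator_globular (C := semidirect)).
    * apply (generator_unit (C := semidirect)).
    * apply (generator_globular (C := semidirect)).
Qed.

(** The decision made in [square] comes out positive on identities, and every proof
    that it does so reduces to the evident one by proof irrelevance. *)
Lemma square_id a b (h k : hom H a b) :
  {E : cell h k = square h k (idm V a) (idm V b)
     | forall x, coerce E x = class (glob x)}.
Proof.
unfold class, square.
destruct (excluded_middle_informative (id_frames (idm V a) (idm V b))) as [i | n]; cbn.
- generalize (id_frames_eql i) (id_frames_eqr i).
  generalize (id_frames_l i) (id_frames_r i); intros; clean_eqs.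
  exists eq_refl; intro x; symmetry; apply value_glob.
- exfalso; apply n; exists eq_refl, eq_refl; split; reflexivity.
Qed.

Lemma horizontalization_semidirect : horizontalization semidirect = B.
Proof.
symmetry; apply (TwoCat_ext (T := B)) with
  (E := fun a b h k => proj1_sig (square_id h k)).
- intros; exact (proj2_sig (square_id h h) _).
- intros a b h k l x y.
  destruct (square_id h k) as [E1 P1], (square_id k l) as [E2 P2],
    (square_id h l) as [E3 P3].
  cbn in *; rewrite P1, P2, P3.
  apply (sq_pack_inj (C := semidirect)); symmetry; unfold gvcomp.
  apply (eq_trans (sq_pack_cast (C := semidirect) _ _ _)).
  cbn; rewrite vcomp_class; apply pack_class.
  rewrite prevcomp_globl, pack_precast; reflexivity.
- intros a b c h h' k k' x y.
  destruct (square_id h h') as [E1 P1], (square_id k k') as [E2 P2],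
    (square_id (h @ k) (h' @ k')) as [E3 P3].
  cbn in *; rewrite P1, P2, P3.
  rewrite hcomp_class, prehcomp_gg; reflexivity.
Qed.

End Presquares.

(** * Internalization of an indexed decorated 2-category *)

Lemma indexing_internalization (D : DecTwoCat) (Phi : Pi2Indexing D) :
  exists C, internalization D C /\
    forall a b c d (h : hom (hor C) a b) (k : hom (hor C) c d) f g (x : sq C h k f g),
      vclosure (@generator C) x.
Proof.
destruct D as [ob V B], Phi as [[F Fh Fid Fc] E]; cbn in *.
assert (EF : F = pi2 B) by (apply functional_extensionality; exact E).
subst F; clear E.
pose (act := fun a c f => mfun (Fh a c f)).
assert (act_id : forall a x, act a a (idm V a) x = x).
{ intros; unfold act; rewrite Fid; reflexivity. }
assert (act_comp : forall a b c (f : hom V a b) (g : hom V b c) x,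
  act a c (comp V f g) x = act b c g (act a b f x)).
{ intros; unfold act; rewrite Fc; reflexivity. }
assert (act1 : forall a c (f : hom V a c), act a c f (mone (pi2 B a)) = mone (pi2 B c)).
{ intros; apply mfun1. }
assert (actM : forall a c (f : hom V a c) x y,
  act a c f (mmul x y) = mmul (act a c f x) (act a c f y)).
{ intros; apply mfunM. }
exists (semidirect act_id act_comp act1 actM); split.
- unfold internalization, decorated_horizontalization.
  rewrite horizontalization_semidirect; reflexivity.
- intros; apply semidirect_vgenerated.
Qed.

(** * Vertical duality *)

Lemma cell_pack_op X (cell : X -> X -> Type) (h k h' k' : X) (x : cell h k) (y : cell h' k') :
  cell_pack x = cell_pack y ->
  cell_pack (cell := fun u v => cell v u) x = cell_pack (cell := fun u v => cell v u) y.
Proof.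
intro E.
exact (f_equal (fun w : {p : X * X & cell (fst p) (snd p)} =>
  cell_pack (cell := fun u v => cell v u) (projT2 w)) E).
Qed.

Definition opTwoCat ob (B : TwoCat ob) : TwoCat ob.
Proof.
refine (@MkTwoCat ob (cells1 B) (fun a b => opCat (cells2 B a b))
  (fun a b c h h' k k' x y => hcomp2 B x y) _ _ _ _ _).
- intros; apply hcomp2_id.
- intros; cbn; apply hcomp2_comp.
- intros; apply (cell_pack_op (cell := hom (cells2 B a b))), hcomp2_idl.
- intros; apply (cell_pack_op (cell := hom (cells2 B a b))), hcomp2_idr.
- intros; apply (cell_pack_op (cell := hom (cells2 B a d))), hcomp2A.
Defined.

Definition vopDec (D : DecTwoCat) : DecTwoCat :=
  MkDecTwoCat (opCat (dec_cat D)) (opTwoCat (dec_two D)).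

Lemma vopDecK (D : DecTwoCat) : vopDec (vopDec D) = D.
Proof.
destruct D as [ob V B]; unfold vopDec; cbn.
f_equal.
- destruct V; unfold opCat; cbn; f_equal; apply proof_irrelevance.
- symmetry; apply (TwoCat_ext (T := B)
    (c2 := fun a b => opCat (opCat (cells2 B a b)))) with (E := fun a b h k => eq_refl);
    reflexivity.
Qed.

Definition vopSq (C : DoubleCat) : SqFamily (opCat (vert C)) (hor C) :=
  fun a b c d h k f g => sq C k h f g.

Lemma sq_pack_vop (C : DoubleCat) a b c d (h h' : hom (hor C) a b)
    (k k' : hom (hor C) c d) (f f' : hom (vert C) a c) (g g' : hom (vert C) b d)
    (x : sq C h k f g) (y : sq C h' k' f' g') :
  sq_pack (S := @sq C) x = sq_pack y ->
  sq_pack (S := @vopSq C) x = sq_pack (S := @vopSq C) y.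
Proof.
intro E.
exact (f_equal (fun w : {p : Boundary (vert C) (hor C) a b c d
    & sq C (bdom p) (bcod p) (bleft p) (bright p)} =>
  sq_pack (S := @vopSq C) (projT2 w : vopSq _ _ _ _)) E).
Qed.

Definition vopDouble (C : DoubleCat) : DoubleCat.
Proof.
refine (@MkDoubleCat (dob C) (opCat (vert C)) (hor C) (@vopSq C)
  (fun a b h => vid C h)
  (fun a b c d a' b' h k l f g f' g' x y => vcomp C y x)
  (fun a c f => hunit C f)
  (fun a b c d e i h k h' k' f g j x y => hcomp C x y)
  _ _ _ _ _ _ _ _ _ _).
- intros; apply (sq_pack_vop (C := C)), vcomp_idr.
- intros; apply (sq_pack_vop (C := C)), vcomp_idl.
- intros; apply (sq_pack_vop (C := C)); symmetry; apply vcompA.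
- intros; apply (hunit_id (d0 := C)).
- intros; apply (hunit_comp (d0 := C)).
- intros; apply (hcomp_vid (d0 := C)).
- intros; apply (interchange (d0 := C)).
- intros; apply (sq_pack_vop (C := C)), hcomp_idl.
- intros; apply (sq_pack_vop (C := C)), hcomp_idr.
- intros; apply (sq_pack_vop (C := C)), hcompA.
Defined.

Lemma decorated_horizontalization_vop (C : DoubleCat) :
  decorated_horizontalization (vopDouble C) = vopDec (decorated_horizontalization C).
Proof.
unfold decorated_horizontalization, vopDec; cbn; f_equal; symmetry.
apply (TwoCat_ext (T := opTwoCat (horizontalization C))
    (c2 := globularCat (C := vopDouble C))) with
  (E := fun a b h k => eq_refl); try reflexivity.
intros; apply (sq_pack_inj (C := vopDouble C)); cbn.
unfold gvcomp; rewrite (sq_pack_cast (C := vopDouble C)).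
apply (sq_pack_vop (C := C)); apply sq_pack_cast.
Qed.

Lemma vclosure_vop (C : DoubleCat) a b c d (h : hom (hor C) a b)
    (k : hom (hor C) c d) f g (x : sq C h k f g) :
  vclosure (@generator C) x ->
  vclosure (@generator (vopDouble C)) (x : sq (vopDouble C) k h f g).
Proof.
induction 1 as [a b c d h k f g x G | a b h |
  a b c d a' b' h k l f g f' g' x y X IHx Y IHy].
- apply vclosure_base; destruct G.
  + apply (generator_globular (C := vopDouble C)).
  + apply (generator_unit (C := vopDouble C)).
- apply (vclosure_id (C := vopDouble C)).
- exact (vclosure_comp (C := vopDouble C) IHy IHx).
Qed.

Lemma CommMonoid_ext (M : CommMonoid) (m : carrier M -> carrier M -> carrier M) p q r :
  (forall x y, mmul x y = m x y) -> M = @MkCommMonoid (carrier M) (mone M) m p q r.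
Proof.
destruct M as [X e n p' q' r']; cbn in *; intro E.
assert (F : n = m) by (do 2 (apply functional_extensionality; intro); apply E).
destruct F; f_equal; apply proof_irrelevance.
Qed.

(** Reversing the 2-cells reverses the product of [pi2], which is commutative. *)
Lemma pi2_op ob (B : TwoCat ob) (a : ob) : pi2 B a = pi2 (opTwoCat B) a.
Proof. apply (CommMonoid_ext (M := pi2 B a)), eckmann_hilton. Qed.

Definition indexing_vop (D : DecTwoCat) (Phi : Pi2Opindexing D) : Pi2Indexing (vopDec D) :=
  @MkPi2Indexing (vopDec D) (pi2_functor Phi)
    (fun a => eq_trans (pi2_functor_ob Phi a) (pi2_op (dec_two D) a)).

Unset Implicit Arguments.

Theorem theorem1p1 (D : DecTwoCat) (Phi : Pi2Indexing D + Pi2Opindexing D) :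
  exists C : DoubleCat, internalization D C /\ is_length C (Some 1).
Proof.
destruct Phi as [Phi | Phi].
- destruct (indexing_internalization Phi) as [C [I G]].
  exists C; split; [exact I | exact (length_one G)].
- destruct (indexing_internalization (indexing_vop Phi)) as [C [I G]].
  exists (vopDouble C); split.
  + unfold internalization in *.
    rewrite decorated_horizontalization_vop, I; apply vopDecK.
  + apply length_one; intros; apply vclosure_vop, G.
Qed.
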